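(* Consider the linear dynamical system under attack $$\mathbf{x}(t+1)=\mathbf{A}\mathbf{x}(t)+\mathbf{B}\mathbf{u}(t)+\mathbf{w}(t),\qquad \mathbf{y}(t)=\mathbf{C}\mathbf{x}(t)+\mathbf{v}(t)+\mathbf{a}(t),$$ with $p$ sensors and a $k$-adversary, and consider an oracle MMSE (minimum mean square error) estimator of $\mathbf{x}(t)$ that has knowledge of $\boldsymbol{\kappa}$, the set of sensors attacked by the $k$-adversary. Then there exist a choice of attacked sensors $\boldsymbol{\kappa}\subseteq\{1,\dots,p\}$, $|\boldsymbol{\kappa}|=k$, and an attack sequence $\mathbf{a}(t)$ such that the error $\mathbf{e}(t)$ of the oracle estimator satisfies $$\mathrm{tr}\big(\mathbb{E}(\mathbf{e}(t)\mathbf{e}^T(t))\big)\ \ge\ \mathrm{tr}\big(\mathbf{P}^\star_{\mathbf{s}_{\text{worst},p-k}}\big).$$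
   Context: System: $\mathbf{x}(t)\in\mathbb{R}^n$ is the state, $\mathbf{y}(t)\in\mathbb{R}^p$ the output (entry $i$ is the output of sensor $i$), $\mathbf{w}(t)\sim\mathcal{N}(\mathbf{0},\sigma_w^2\mathbf{I}_n)$ and $\mathbf{v}(t)\sim\mathcal{N}(\mathbf{0},\sigma_v^2\mathbf{I}_p)$ are the process and sensor noise, i.i.d. over time and independent of each other. The input $\mathbf{u}(t)$ is known; throughout, without loss of generality, $\mathbf{u}(t)=0$ for all $t\in\mathbb{N}$. $k$-adversary: it attacks a set $\boldsymbol{\kappa}\subseteq\{1,\dots,p\}$ of $k$ sensors, fixed over time; it can observe the actual outputs of the attacked sensors and change them arbitrarily, while $\mathbf{a}_j(t)=0$ for all $t$ if $j\notin\boldsymbol{\kappa}$. It has unbounded computational power and knows the system parameters and noise statistics. Its knowledge at time $t$ (hence $\mathbf{a}(t)$) is statistically independent of $\{\mathbf{w}(t')\}_{t'>t}$ and, for each attack-free sensor $i\notin\boldsymbol{\kappa}$, of $\{v_i(t')\}_{t'>t}$. Kalman filters: for a sensor subset $\mathbf{s}$, $\mathbf{C}_{\mathbf{s}}$ is the matrix formed by the rows of $\mathbf{C}$ indexed by $\mathbf{s}$, and $\hat{\mathbf{x}}^\star_{\mathbf{s}}(t)$ is the Kalman filter estimate of $\mathbf{x}(t)$ using the outputs up to time $t-1$ of the sensors in $\mathbf{s}$ (prediction version) when all sensors in $\mathbf{s}$ are attack-free. All Kalman filters are assumed to be in steady state when using uncorrupted outputs, so that the error covariance $\mathbf{P}^\star_{\mathbf{s}}=\mathbb{E}\big((\mathbf{x}(t)-\hat{\mathbf{x}}^\star_{\mathbf{s}}(t))(\mathbf{x}(t)-\hat{\mathbf{x}}^\star_{\mathbf{s}}(t))^T\big)$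 does not depend on $t$; the oracle estimator is likewise a prediction-type estimator in this steady-state setting. Finally, $$\mathbf{s}_{\text{worst},p-k}=\arg\max_{\mathbf{s}\subseteq\{1,\dots,p\},\ |\mathbf{s}|=p-k}\mathrm{tr}(\mathbf{P}^\star_{\mathbf{s}}).$$ *)

(* Defs.v *)
From HB Require Import structures.
From mathcomp Require Import all_boot all_order all_algebra.
From mathcomp Require Import all_classical all_reals all_analysis.

Set Implicit Arguments.
Unset Strict Implicit.
Unset Printing Implicit Defensive.

Import Order.TTheory GRing.Theory Num.Theory.
Import numFieldNormedType.Exports.

Local Open Scope classical_set_scope.
Local Open Scope ring_scope.

Section SigmaAlgebras.
Context {R : realType} {T : Type}.

Definition component {n : nat} (X : T -> 'cV[R]_n) (i : 'I_n) : T -> R :=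
  fun omega => X omega i ord0.

Definition sigma_of (F : set (T -> R)) : set_system T :=
  <<s \bigcup_(f in F) preimage_set_system setT f measurable >>.

Definition sigma_vec {n : nat} (X : T -> 'cV[R]_n) : set_system T :=
  sigma_of (range (component X)).

(* What the readings [y tau i], for [(tau, i)] in [S], reveal. *)
Definition sigma_readings {p : nat} (y : int -> T -> 'cV[R]_p)
    (S : set (int * 'I_p)) : set_system T :=
  sigma_of [set component (y q.1) q.2 | q in S].

Definition vec_measurable_wrt {n : nat} (F : set_system T)
    (X : T -> 'cV[R]_n) : Prop :=
  forall i, preimage_set_system setT (component X i) measurable `<=` F.

End SigmaAlgebras.

Section Probability.
Context {d : measure_display} {T : measurableType d} {R : realType}.
Variable P : probability T R.

Definition random_vector {n : nat} (X : T -> 'cV[R]_n) : Prop :=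
  forall i, measurable_fun setT (component X i).

Definition independent2 (F G : set_system T) : Prop :=
  forall A B, F A -> G B -> P (A `&` B) = (P A * P B)%E.

Definition mutually_independent {I : eqType} (F : I -> set_system T) : Prop :=
  forall (J : seq I) (E : I -> set T), uniq J ->
    (forall i, i \in J -> F i (E i)) ->
    P (\bigcap_(i in [set` J]) E i) = (\prod_(i <- J) P (E i))%E.

Definition standard_normal_vector {r : nat} (G : T -> 'cV[R]_r) : Prop :=
  [/\ random_vector G,
      forall i (B : set R), measurable B ->
        P (component G i @^-1` B) = normal_prob 0 1 B
    & mutually_independent (fun i : 'I_r => sigma_of [set component G i])].

(* [X ~ N(mu, Sigma)], for a possibly singular [Sigma]: [X] is almost surely
   the affine image [mu + M G] of a standard normal vector, [M M^T = Sigma]. *)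
Definition gaussian_vector {n : nat} (X : T -> 'cV[R]_n)
    (mu : 'cV[R]_n) (Sigma : 'M[R]_n) : Prop :=
  random_vector X /\
  exists (r : nat) (M : 'M[R]_(n, r)) (G : T -> 'cV[R]_r),
    [/\ standard_normal_vector G, M *m M^T = Sigma
      & {ae P, forall omega, X omega = mu + M *m G omega}].

(* [E(e e^T)], with extended real entries: it makes sense whether or not [e]
   is square integrable. *)
Definition second_moment {n : nat} (e : T -> 'cV[R]_n) : 'M[\bar R]_n :=
  \matrix_(i, j) ('E_P[fun omega => (e omega *m (e omega)^T)%R i j])%E.

Definition mean_square {n : nat} (e : T -> 'cV[R]_n) : \bar R :=
  ('E_P[fun omega => (\sum_i (e omega i ord0) ^+ 2)%R])%E.

Definition error {n : nat} (X Xhat : T -> 'cV[R]_n) : T -> 'cV[R]_n :=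
  fun omega => X omega - Xhat omega.

(* [Xhat] is a minimum mean square error estimator of [X] from the
   information [F]: the competitors are all the [F]-measurable vectors. *)
Definition mmse_estimator {n : nat} (F : set_system T)
    (X Xhat : T -> 'cV[R]_n) : Prop :=
  vec_measurable_wrt F Xhat /\
  forall g : T -> 'cV[R]_n, vec_measurable_wrt F g ->
    (mean_square (error X Xhat) <= mean_square (error X g))%E.

End Probability.

Section System.
Context {d : measure_display} {T : measurableType d} {R : realType}.
Variable P : probability T R.
Variables (n m p : nat).
Variables (A : 'M[R]_n) (B : 'M[R]_(n, m)) (C : 'M[R]_(p, n)).
Variables (sigma_w sigma_v : R).
Variable u : nat -> 'cV[R]_m.
Variable x : nat -> T -> 'cV[R]_n.
Variables (w : nat -> T -> 'cV[R]_n) (v : nat -> T -> 'cV[R]_p).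

(* The attack-free outputs of all the sensors. Time is indexed by [int]: for
   the filters to be in steady state at time 0, the sensors must have been
   read before time 0. No output equation is imposed at negative times (an
   unstable system driven by noise has no two-sided trajectory); these old
   readings enter only through their joint law with [x 0]. *)
Variable z : int -> T -> 'cV[R]_p.

Definition initial_data : set_system T :=
  sigma_of (range (component (x 0%N)) `|`
            [set component (z q.1) q.2 | q in [set q : int * 'I_p | q.1 < 0]]).

(* [None]: the data up to time 0; [inl t]: process noise; [inr t]: sensor
   noise. *)
Definition randomness (i : option (nat + nat)) : set_system T :=
  match i with
  | None => initial_data
  | Some (inl t) => sigma_vec (w t)
  | Some (inr t) => sigma_vec (v t)
  end.

Record attack_free_system : Prop := AttackFreeSystem {
  state_rv : random_vector (x 0%N);
  output_rv : forall tau, random_vector (z tau);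
  state_eq : forall (t : nat) omega,
    x t.+1 omega = A *m x t omega + B *m u t + w t omega;
  output_eq : forall (t : nat) omega,
    z t%:Z omega = C *m x t omega + v t omega;
  process_noise : forall t, gaussian_vector P (w t) 0 (sigma_w ^+ 2)%:M;
  sensor_noise : forall t, gaussian_vector P (v t) 0 (sigma_v ^+ 2)%:M;
  noise_indep : mutually_independent P randomness
}.

Section KalmanFilter.
Variable s : {set 'I_p}.

Definition rows {q : nat} (M : 'M[R]_(p, q)) : 'M[R]_(#|s|, q) :=
  rowsub (fun i : 'I_#|s| => enum_val i) M.

(* The covariance of the innovation is invertible, and [pinvmx] is [invmx]
   on it, as soon as [sigma_v != 0]. If [sigma_v = 0] it may be singular, and
   [pinvmx] is a generalized inverse. *)
Definition kalman_gain (S : 'M[R]_n) : 'M[R]_(n, #|s|) :=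
  A *m S *m (rows C)^T *m
  pinvmx (rows C *m S *m (rows C)^T + (sigma_v ^+ 2)%:M).

(* One-step predictor for the sensors in [s], started at time 0 from the
   estimate [xhat0] with error covariance [S0]. *)
Fixpoint kalman_cov (S0 : 'M[R]_n) (t : nat) : 'M[R]_n :=
  if t is t'.+1 then
    let S := kalman_cov S0 t' in
    A *m S *m A^T + (sigma_w ^+ 2)%:M
    - kalman_gain S *m rows C *m S *m A^T
  else S0.

Fixpoint kalman_estimate (S0 : 'M[R]_n) (xhat0 : T -> 'cV[R]_n) (t : nat)
    : T -> 'cV[R]_n :=
  if t is t'.+1 then fun omega =>
    let xhat := kalman_estimate S0 xhat0 t' omega in
    A *m xhat + B *m u t'
    + kalman_gain (kalman_cov S0 t') *m
      (rows (z t'%:Z omega) - rows C *m xhat)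
  else xhat0.

Definition past_readings : set_system T :=
  sigma_readings z [set q | q.1 < 0 /\ q.2 \in s].

(* The first three items say that, given the readings of [s] before time 0,
   [x 0] has law [N(xhat0, Pstar)]. *)
Record steady_state_kalman (Pstar : 'M[R]_n) (xhat0 : T -> 'cV[R]_n)
    : Prop := SteadyStateKalman {
  init_measurable : vec_measurable_wrt past_readings xhat0;
  init_gaussian : gaussian_vector P (error (x 0%N) xhat0) 0 Pstar;
  init_indep :
    independent2 P (sigma_vec (error (x 0%N) xhat0)) past_readings;
  steady_cov : forall t : nat,
    second_moment P (error (x t) (kalman_estimate Pstar xhat0 t))
    = map_mx EFin Pstar
}.

End KalmanFilter.

Section Adversary.
Variable k : nat.
Variable kappa : {set 'I_p}.
Variable a : int -> T -> 'cV[R]_p.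

(* [K t] is the knowledge of the adversary at time [t]. It contains at least
   the actual outputs of the attacked sensors, and may contain anything that
   is independent of the noise to come. *)
Record adversary_knowledge (K : int -> set_system T) : Prop :=
  AdversaryKnowledge {
  knowledge_sigma : forall t, sigma_algebra setT (K t);
  knowledge_event : forall t, K t `<=` measurable;
  knowledge_mono : forall t t', t <= t' -> K t `<=` K t';
  knowledge_outputs : forall t,
    sigma_readings z [set q | q.1 <= t /\ q.2 \in kappa] `<=` K t;
  knowledge_attack : forall t, vec_measurable_wrt (K t) (a t);
  knowledge_process : forall t : int,
    independent2 P (K t)
      (sigma_of [set component (w q.1) q.2 | q in
                  [set q : nat * 'I_n | t < q.1%:Z]]);
  knowledge_sensor : forall (t : int) (i : 'I_p), i \notin kappa ->
    independent2 P (K t)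
      (sigma_of [set component (v t') i | t' in [set t' : nat | t < t'%:Z]])
}.

Definition k_adversary : Prop :=
  [/\ #|kappa| = k,
      forall t omega i, i \notin kappa -> a t omega i ord0 = 0
    & exists K, adversary_knowledge K].

(* The attack bears on the readings made before time 0 as well: the record
   accumulated in the steady state is also under attack. *)
Definition attacked_output (t : int) (omega : T) : 'cV[R]_p :=
  z t omega + a t omega.

(* The readings, before time [t], of all the sensors, attacked or not. As
   [kappa] is not random, an estimator that knows [kappa] is still a function
   of these readings. *)
Definition oracle_information (t : nat) : set_system T :=
  sigma_readings attacked_output [set q | q.1 < t%:Z].

End Adversary.
End System.

Definition is_worst_subset {R : realType} {n p : nat} (q : nat)
    (Pstar : {set 'I_p} -> 'M[R]_n) (s : {set 'I_p}) : Prop :=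
  #|s| = q /\
  forall s' : {set 'I_p}, #|s'| = q -> \tr (Pstar s') <= \tr (Pstar s).

(* Main.v *)
From HB Require Import structures.
Require Import Defs.
From mathcomp Require Import all_boot all_order all_algebra.
From mathcomp Require Import all_classical all_reals all_analysis.
From mathcomp Require Import measurable_realfun simple_functions.
From mathcomp Require Import measurable_fun_approximation ring lra zify.

(** The attacked sensors are those outside [s_worst], and the attack cancels
    their outputs, so that every attacked reading is identically 0. What the
    oracle sees before time [t] is then contained in the sigma-algebra of the
    readings of [s_worst] before [t], and its estimate is one measurable function
    of these readings among others. The Kalman filter of [s_worst], which has mean
    square error [tr Pstar], is optimal among all such functions, linear or not.

    The optimality needs only that each component of the filtering error [e_t]
    integrates to 0 over every event of the past [F_t] of [s_worst]: for an
    [F_t]-measurable correction [g], the cross term of [E (e + g) ^ 2] then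
    vanishes ([centered_optimal]). This orthogonality comes from Gaussianity,
    which enters through the Stein identity
      E (1_B X_i f(X)) = sum_j S_ij E (1_B (D_j f)(X)),
    required for all [B] in a sigma-algebra [F] and all bounded [C^1] functions
    [f] with bounded gradient ([gaussian_given]). It is a way to say that [X] has
    law [N(0, S)] and is independent of [F] without densities, characteristic
    functions or conditional laws, and it behaves well under what a filter does:
    - a standard normal vector satisfies it, by one integration by parts per
      coordinate ([stein_normal], [standard_normal_gaussian]);
    - it is stable under linear maps ([gaussian_given_mulmx]) and under the
      addition of an independent vector, by Fubini ([gaussian_given_add]);
    - if the pair [(X, Y)] satisfies it given [F] and the cross-covariance of [X]
      and [Y] is 0, then [X] satisfies it given [F] and [Y]
      ([gaussian_given_absorb]): test functions that depend on [Y] act as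
      constants in the identity for [X], and their limits include the indicators
      of a pi-system that generates the sigma-algebra of [Y].

    The induction over time ([kalman_filter_gaussian]) follows. The next error and
    the innovation are linear images of [e_t] and of the fresh noises, and the
    Kalman gain is what makes them uncorrelated ([innovation_uncorrelated]), also
    when the innovation covariance is singular, because the error covariance
    stays a Gram matrix ([kalman_cov_gram]). Absorbing the innovation turns the
    past at time [t] into the past at time [t + 1]. *)

Set Implicit Arguments.
Unset Strict Implicit.
Unset Printing Implicit Defensive.
Import Order.TTheory GRing.Theory Num.Theory.
Import numFieldNormedType.Exports.
Local Open Scope classical_set_scope.
Local Open Scope ring_scope.

(** * Independence of generated sigma-algebras *)

Section Independence.
Context {d : measure_display} {T : measurableType d} {R : realType}.
Variable P : probability T R.
Implicit Types (F G H C D : set_system T).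

Lemma pi_lambda C D :
  setI_closed C -> C `<=` D -> dynkin D -> <<s C >> `<=` D.
Proof.
by move=> CI CD dD; rewrite -setI_closed_g_dynkin_g_sigma_algebra//;
  exact: smallest_sub.
Qed.

(** Both sides of the product rule are countably additive in [A], so the class
    of the events that satisfy it with a fixed [B] only has to be checked on a
    pi-system. *)
Lemma dynkin_indep (B : set T) : measurable B ->
  dynkin [set A | measurable A /\ P (A `&` B) = (P A * P B)%E].
Proof.
move=> mB; split=> /=.
- by split=> //; rewrite setTI probability_setT mul1e.
- move=> A [mA PAB]; split; first exact: measurableC.
  rewrite setIC -setDE measureD//=; last first.
    by rewrite (le_lt_trans (probability_le1 P mB)) ?ltry.
  rewrite setIC PAB probability_setC// muleBl ?fin_num_measure//.
  by rewrite mul1e.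
- move=> A tA AB; have mA n : measurable (A n) by have [] := AB n.
  split; first exact: bigcupT_measurable.
  rewrite setI_bigcupl !measure_bigcup//; last 2 first.
  - by move=> n _; apply: measurableI.
  - exact: trivIset_setIr.
  rewrite -(fineK (fin_num_measure P B mB)) muleC -nneseriesZl//.
  apply: eq_eseriesr => n _; have [_ /= AnB] := AB n.
  by rewrite /= AnB muleC fineK// fin_num_measure.
Qed.

(** Independence of two pi-systems passes to the sigma-algebras they generate:
    one application of the pi-lambda theorem for each side. *)
Lemma independent2_pi C D :
  C `<=` measurable -> D `<=` measurable -> setI_closed C -> setI_closed D ->
  independent2 P C D -> independent2 P <<s C >> <<s D >>.
Proof.
move=> mC mD CI DI CD.
have step A B : <<s C >> A -> D B -> P (A `&` B) = (P A * P B)%E.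
  move=> sA DB.
  suff [] : measurable A /\ P (A `&` B) = (P A * P B)%E by [].
  apply: (pi_lambda CI _ (dynkin_indep (mD _ DB))) sA => A' CA'.
  by split; [exact: mC | exact: CD].
move=> A B sA sB; rewrite setIC muleC.
have mA : measurable A by exact: (smallest_sub (@sigma_algebra_measurable _ T) mC).
suff [] : measurable B /\ P (B `&` A) = (P B * P A)%E by [].
apply: (pi_lambda DI _ (dynkin_indep mA)) sB => B' DB'.
by split; [exact: mD | rewrite setIC muleC step].
Qed.

Lemma independent2_sub F G F' G' :
  F' `<=` F -> G' `<=` G -> independent2 P F G -> independent2 P F' G'.
Proof. by move=> FF GG FG A B FA GB; apply: FG; [exact: FF | exact: GG]. Qed.

Lemma independent2_sym F G : independent2 P F G -> independent2 P G F.
Proof. by move=> FG A B GA FB; rewrite setIC muleC FG. Qed.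

Definition family_algebra {I : Type} (F : I -> set_system T) (J : set I) :
    set_system T := <<s \bigcup_(i in J) F i >>.

Lemma family_algebra_sub {I : Type} (F : I -> set_system T) (J : set I) i :
  J i -> F i `<=` family_algebra F J.
Proof. by move=> Ji A FA; apply: sub_sigma_algebra; exists i. Qed.

(** The pi-system that generates [family_algebra F J], on which mutual
    independence gives the product rule directly. *)
Let finite_meets {I : choiceType} (F : I -> set_system T) (J : set I) :
    set_system T :=
  [set A | exists (s : seq I) (E : I -> set T),
    [/\ uniq s, forall i, i \in s -> J i, forall i, i \in s -> F i (E i)
      & A = \bigcap_(i in [set` s]) E i]].

Let finite_meets_setI {I : choiceType} (F : I -> set_system T) (J : set I) :
  (forall i, sigma_algebra setT (F i)) -> setI_closed (finite_meets F J).
Proof.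
move=> sF _ _ [s1 [E1 [_ sJ1 FE1 ->]]] [s2 [E2 [_ sJ2 FE2 ->]]].
have FT i : F i setT by exact: dynkinT (sigma_algebra_dynkin (sF i)).
have FI i A B : F i A -> F i B -> F i (A `&` B).
  move=> FA FB; have := @measurableI _ (g_sigma_algebraType (F i)) A B.
  by rewrite (measurable_g_measurableTypeE (sF i)); apply.
pose E i := (if i \in s1 then E1 i else setT) `&`
            (if i \in s2 then E2 i else setT).
exists (undup (s1 ++ s2)), E; split.
- exact: undup_uniq.
- by move=> i; rewrite mem_undup mem_cat => /orP[/sJ1|/sJ2].
- by move=> i _; apply: FI; case: ifPn => // ?; [exact: FE1 | exact: FE2].
- rewrite predeqE => w; split=> [[w1 w2] i /= _|w12].
  + by split; case: ifPn => // ?; [exact: w1 | exact: w2].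
  + split=> i /= si.
    * have /= := w12 i; rewrite mem_undup mem_cat si => /(_ isT)[].
      by rewrite si.
    * have /= := w12 i; rewrite mem_undup mem_cat si orbT => /(_ isT)[_].
      by rewrite si.
Qed.

(** Mutual independence is a statement on one event per index. It extends to
    blocks of indices because two finite families with disjoint supports form
    one finite family. *)
Lemma mutually_independent_split {I : choiceType} (F : I -> set_system T)
    (J K : set I) :
  (forall i, sigma_algebra setT (F i)) -> (forall i, F i `<=` measurable) ->
  mutually_independent P F -> J `&` K = set0 ->
  independent2 P (family_algebra F J) (family_algebra F K).
Proof.
move=> sF mF iF JK.
have gen L : family_algebra F L `<=` <<s finite_meets F L >>.
  apply: smallest_sub; first exact: smallest_sigma_algebra.
  move=> A [i Li FA]; apply: sub_sigma_algebra.
  exists [:: i], (fun=> A); split=> //.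
  - by move=> j; rewrite inE => /eqP ->.
  - by move=> j; rewrite inE => /eqP ->.
  - rewrite predeqE => w; split=> [wA j //|]; apply; exact: mem_head.
have meas L : finite_meets F L `<=` measurable.
  move=> _ [s [E [_ _ FE ->]]]; rewrite bigcap_seq.
  rewrite big_seq; apply: (big_ind (fun A => measurable A)) => //.
  - exact: measurableI.
  - by move=> i si; apply: mF; exact: FE.
have piF L := finite_meets_setI (J := L) sF.
apply: independent2_sub (gen J) (gen K) _.
apply: independent2_pi => //.
move=> _ _ [s1 [E1 [u1 sJ1 FE1 ->]]] [s2 [E2 [u2 sJ2 FE2 ->]]].
have dis i : i \in s1 -> i \in s2 -> False.
  move=> /sJ1 Ji /sJ2 Ki; suff: (J `&` K) i by rewrite JK.
  by split.
pose E i := if i \in s1 then E1 i else E2 i.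
have E1E i : i \in s1 -> E i = E1 i by rewrite /E => ->.
have E2E i : i \in s2 -> E i = E2 i.
  by move=> s2i; rewrite /E; case: ifPn => // /dis /(_ s2i).
have -> : \bigcap_(i in [set` s1]) E1 i `&` \bigcap_(i in [set` s2]) E2 i
    = \bigcap_(i in [set` s1 ++ s2]) E i.
  rewrite predeqE => w; split=> [[w1 w2] i /=|w12].
  - rewrite mem_cat => /orP[si|si]; first by rewrite E1E//; exact: w1.
    by rewrite E2E//; exact: w2.
  - split=> i /= si.
    + by rewrite -E1E//; apply: w12; rewrite /= mem_cat si.
    + by rewrite -E2E//; apply: w12; rewrite /= mem_cat si orbT.
rewrite iF; last 2 first.
- rewrite cat_uniq u1 u2 andbT/=; apply/hasPn => i s2i.
  by apply/negP => /dis; exact.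
- move=> i; rewrite mem_cat => /orP[si|si]; first by rewrite E1E//; exact: FE1.
  by rewrite E2E//; exact: FE2.
rewrite big_cat/= (iF s1 E1)// (iF s2 E2)//.
by congr (_ * _)%E; apply: eq_big_seq => i si; [rewrite E1E | rewrite E2E].
Qed.
End Independence.

(** * Averaging over independent sources of randomness *)

Section Decoupling.
Context {d : measure_display} {T : measurableType d} {R : realType}.
Variable P : probability T R.

Lemma joint_distribution_indep d1 d2 (T1 : measurableType d1)
    (T2 : measurableType d2) (X : {mfun T >-> T1}) (Y : {mfun T >-> T2})
    (XY : {mfun T >-> (T1 * T2)%type}) :
  (forall w, XY w = (X w, Y w)) ->
  (forall A B, measurable A -> measurable B ->
    P (X @^-1` A `&` Y @^-1` B) = (P (X @^-1` A) * P (Y @^-1` B))%E) ->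
  forall Z, measurable Z ->
    (distribution P X \x distribution P Y)%E Z = distribution P XY Z.
Proof.
move=> XYE indep; apply: product_measure_unique => A B mA mB.
rewrite /distribution /pushforward -indep//; congr (P _).
by rewrite predeqE => w /=; rewrite XYE.
Qed.

(** Under independence the joint law is the product of the marginals, so Fubini
    allows to freeze the second variable. The bound by a function of the first
    variable alone gives the integrability on the product. *)
Lemma integral_indep_eq0 d1 d2 (T1 : measurableType d1)
    (T2 : measurableType d2) (X : T -> T1) (Y : T -> T2)
    (f : T1 * T2 -> R) (K : T1 -> R) :
  measurable_fun setT X -> measurable_fun setT Y ->
  (forall A B, measurable A -> measurable B ->
    P (X @^-1` A `&` Y @^-1` B) = (P (X @^-1` A) * P (Y @^-1` B))%E) ->
  measurable_fun setT f -> measurable_fun setT K ->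
  P.-integrable setT (EFin \o (K \o X)) ->
  (forall x y, `|f (x, y)| <= K x) ->
  (forall y, (\int[P]_w (f (X w, y))%:E = 0)%E) ->
  (\int[P]_w (f (X w, Y w))%:E = 0)%E.
Proof.
move=> mX mY indep mf mK iK fK f0.
have mXY : measurable_fun setT (fun w => (X w, Y w)).
  exact: measurable_fun_pair.
pose X' : {mfun T >-> T1} := HB.pack X (isMeasurableFun.Build _ _ _ _ _ mX).
pose Y' : {mfun T >-> T2} := HB.pack Y (isMeasurableFun.Build _ _ _ _ _ mY).
pose XY' : {mfun T >-> (T1 * T2)%type} :=
  HB.pack (fun w => (X w, Y w)) (isMeasurableFun.Build _ _ _ _ _ mXY).
have joint := @joint_distribution_indep _ _ _ _ X' Y' XY' (fun=> erefl) indep.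
have mEf : measurable_fun setT (EFin \o f) by exact/measurable_EFinP.
have iKX : (distribution P X').-integrable setT (EFin \o K).
  by apply: integrable_pushforward => //; exact/measurable_EFinP.
have K0 x : 0 <= K x.
  by rewrite (le_trans _ (fK x (Y point)))// normr_ge0.
have iprod : (distribution P X' \x distribution P Y')%E.-integrable setT (EFin \o f).
  apply/integrable12ltyP => //; rewrite /=.
  apply: (@le_lt_trans _ _ (\int[distribution P X']_x (K x)%:E)%E); last first.
    exact: integrable_lty.
  apply: ge0_le_integral => //=.
  - by move=> x _; exact: integral_ge0.
  - apply: (measurable_fun_fubini_tonelli_F (abse \o (EFin \o f))) => //=.
    exact: measurableT_comp.
  - exact/measurable_EFinP.
  - move=> x _; apply: (@le_trans _ _ (\int[distribution P Y']_y (K x)%:E)%E).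
      apply: ge0_le_integral => //=.
      + do 2!apply: measurableT_comp => //.
        exact: (measurableT_comp mf (pair1_measurable x)).
      + by move=> y _; rewrite lee_fin.
    rewrite integral_cst// [X in (_ * X)%E](_ : _ = 1%E) ?mule1//.
    exact: (@probability_setT _ _ _ (distribution P Y')).
have -> : (\int[P]_w (f (X w, Y w))%:E =
    \int[distribution P XY']_z (f z)%:E)%E.
  rewrite integral_pushforward//=.
  apply: le_integrable iK => //; first exact: measurableT_comp.
  by move=> w _ /=; rewrite lee_fin (le_trans (fK _ (Y w)))// ler_norm.
rewrite (eq_measure_integral (distribution P X' \x distribution P Y')%E);
  last by move=> Z mZ _; exact/esym/joint.
rewrite -(integral21_prod_meas1 iprod) integral0_eq// => y _.
rewrite /fubini_G integral_pushforward//=.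
- by apply: measurableT_comp => //; exact: (measurableT_comp mf (pair2_measurable y)).
- apply: le_integrable iK => //.
    apply: measurableT_comp => //; apply: measurableT_comp => //.
    exact: (measurableT_comp mf (pair2_measurable y)).
  by move=> w _ /=; rewrite lee_fin (le_trans (fK _ y))// ler_norm.
Qed.

Definition measurable_wrt (F : set_system T) (f : T -> R) : Prop :=
  preimage_set_system setT f measurable `<=` F.

Lemma measurable_wrtP (F : set_system T) (f : T -> R) :
  sigma_algebra setT F ->
  measurable_wrt F f <->
  measurable_fun (setT : set (g_sigma_algebraType F)) f.
Proof.
move=> sF; have EF := measurable_g_measurableTypeE sF; split=> mf.
- by move=> _ B mB; rewrite EF; apply: mf; exists B.
- by move=> _ [B mB <-]; rewrite -EF; apply: mf => //; rewrite EF.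
Qed.

Lemma measurable_wrt_sub (F G : set_system T) (f : T -> R) :
  F `<=` G -> measurable_wrt F f -> measurable_wrt G f.
Proof. by move=> FG mf A /mf /FG. Qed.

Lemma measurable_wrt_ambient (F : set_system T) (f : T -> R) :
  F `<=` measurable -> measurable_wrt F f -> measurable_fun setT f.
Proof. by move=> mF mf _ B mB; apply/mF/mf; exists B. Qed.

(** For independent sigma-algebras [F] and [H], the identity map of [T] is a
    random element in two ways, measurable for [F] and for [H]. Applied to this
    pair, [integral_indep_eq0] replaces the diagonal by the product space. *)
Lemma integral_decouple_eq0 (F H : set_system T) (f : T * T -> R) (K : T -> R) :
  sigma_algebra setT F -> sigma_algebra setT H ->
  F `<=` measurable -> H `<=` measurable -> independent2 P F H ->
  measurable_fun
    (setT : set (g_sigma_algebraType F * g_sigma_algebraType H)%type) f ->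
  measurable_wrt F K -> P.-integrable setT (EFin \o K) ->
  (forall x y, `|f (x, y)| <= K x) ->
  (forall y, (\int[P]_w (f (w, y))%:E = 0)%E) ->
  (\int[P]_w (f (w, w))%:E = 0)%E.
Proof.
move=> sF sH mF mH FH mf mK iK fK f0.
have EF := measurable_g_measurableTypeE sF.
have EH := measurable_g_measurableTypeE sH.
have mid (G : set_system T) : sigma_algebra setT G -> G `<=` measurable ->
    measurable_fun (setT : set T) (idfun : T -> g_sigma_algebraType G).
  by move=> sG mG _ A; rewrite (measurable_g_measurableTypeE sG) setTI; exact: mG.
apply: (@integral_indep_eq0 _ _ (g_sigma_algebraType F) (g_sigma_algebraType H)
  idfun idfun f K) => //.
- exact: mid.
- exact: mid.
- by move=> A B; rewrite EF EH; exact: FH.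
- exact/measurable_wrtP.
Qed.

End Decoupling.

Section SigmaOf.
Context {d : measure_display} {T : measurableType d} {R : realType}.

Lemma sigma_of_algebra (F : set (T -> R)) : sigma_algebra setT (sigma_of F).
Proof. exact: smallest_sigma_algebra. Qed.

Lemma sigma_of_measurable (F : set (T -> R)) f :
  F f -> measurable_wrt (sigma_of F) f.
Proof. by move=> Ff A fA; apply: sub_sigma_algebra; exists f. Qed.

Lemma sigma_of_sub (F : set (T -> R)) H : sigma_algebra setT H ->
  (forall f, F f -> measurable_wrt H f) -> sigma_of F `<=` H.
Proof.
by move=> sH FH; apply: smallest_sub => // A [f Ff fA]; exact: FH fA.
Qed.

Lemma family_algebraP {I : Type} (F : I -> set_system T) (J : set I) :
  sigma_algebra setT (family_algebra F J).
Proof. exact: smallest_sigma_algebra. Qed.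

Lemma family_algebra_measurable {I : Type} (F : I -> set_system T) (J : set I) :
  (forall i, F i `<=` measurable) -> family_algebra F J `<=` measurable.
Proof.
move=> mF; apply: smallest_sub; first exact: sigma_algebra_measurable.
by move=> A [i _ /mF].
Qed.

Lemma family_algebra_mono {I : Type} (F : I -> set_system T) (J J' : set I) :
  J `<=` J' -> family_algebra F J `<=` family_algebra F J'.
Proof.
move=> JJ; apply: smallest_sub; first exact: family_algebraP.
by move=> A [i Ji FA]; apply: sub_sigma_algebra; exists i => //; exact: JJ.
Qed.

Lemma measurable_wrt_measurable (f : T -> R) :
  measurable_fun setT f -> measurable_wrt measurable f.
Proof. by move=> mf _ [B mB <-]; exact: mf. Qed.

End SigmaOf.

(** * Random vectors and test functions *)

Section RandomVectors.
Context {R : realType} {d : measure_display} {T : measurableType d}.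

Lemma random_vector_mulmx n q (M : 'M[R]_(q, n)) (X : T -> 'cV[R]_n) :
  random_vector X -> random_vector (fun w => M *m X w).
Proof.
move=> mX i; rewrite (_ : component _ i =
    fun w => \sum_j M i j * component X j w); last first.
  by apply/funext => w; rewrite /component mxE.
by apply: measurable_sum => j; exact: measurable_funM.
Qed.

Lemma random_vectorD n (X Y : T -> 'cV[R]_n) :
  random_vector X -> random_vector Y -> random_vector (fun w => X w + Y w).
Proof.
move=> mX mY i; rewrite (_ : component _ i =
    component X i \+ component Y i); last first.
  by apply/funext => w; rewrite /component mxE.
exact: measurable_funD.
Qed.

Lemma random_vectorB n (X Y : T -> 'cV[R]_n) :
  random_vector X -> random_vector Y -> random_vector (fun w => X w - Y w).
Proof.
move=> mX mY i; rewrite (_ : component _ i =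
    component X i \- component Y i); last first.
  by apply/funext => w; rewrite /component !mxE.
exact: measurable_funB.
Qed.

Lemma random_vector_cst n (y : 'cV[R]_n) : random_vector (fun _ : T => y).
Proof. by move=> i; exact: measurable_cst. Qed.

Lemma random_vectorZ n (f : T -> R) (X : T -> 'cV[R]_n) :
  measurable_fun setT f -> random_vector X ->
  random_vector (fun w => f w *: X w).
Proof.
move=> mf mX i; rewrite (_ : component _ i = f \* component X i); last first.
  by apply/funext => w; rewrite /component mxE.
exact: measurable_funM.
Qed.

End RandomVectors.

Section TestFunctions.
Context {R : realType}.

Definition dot {n} (a b : 'cV[R]_n) : R := (a^T *m b) 0 0.

(** Bounded functions that are continuously differentiable along lines, with
    bounded gradient [Df]. Measurability is asked for after composition with
    any random vector, which avoids the choice of a sigma-algebra on ['cV_n]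
    and is stable under all the operations below. *)
Record test_function {n : nat} (f : 'cV[R]_n -> R) (Df : 'cV[R]_n -> 'cV[R]_n)
    : Prop := TestFunction {
  test_measurable : forall d (T : measurableType d) (X : T -> 'cV[R]_n),
    random_vector X -> measurable_fun setT (fun w => f (X w));
  test_grad_measurable : forall d (T : measurableType d) (X : T -> 'cV[R]_n),
    random_vector X -> random_vector (fun w => Df (X w));
  test_bounded : exists c, 0 <= c /\
    forall x, `|f x| <= c /\ forall i, `|Df x i 0| <= c;
  test_derive : forall x a (t : R),
    is_derive t 1 (fun s => f (x + s *: a)) (dot (Df (x + t *: a)) a);
  test_continuous : forall x a,
    continuous (fun t : R => dot (Df (x + t *: a)) a)
}.

Arguments test_derive [n f Df] _ x a t.
Arguments test_continuous [n f Df] _ x a.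

Lemma test_cst1 n : test_function (fun _ : 'cV[R]_n => 1) (fun=> 0).
Proof.
split.
- by move=> d T X _; exact: measurable_cst.
- by move=> d T X _; exact: random_vector_cst.
- exists 1; split=> // x; rewrite normr1; split=> // i.
  by rewrite mxE normr0.
- by move=> x a t; rewrite /dot trmx0 mul0mx mxE; exact: is_derive_cst.
- move=> x a; rewrite /dot trmx0 mul0mx mxE => t; exact: cvg_cst.
Qed.

Lemma test_translate n (f : 'cV[R]_n -> R) Df (y : 'cV[R]_n) :
  test_function f Df ->
  test_function (fun x => f (x + y)) (fun x => Df (x + y)).
Proof.
move=> tf; split.
- move=> d T X mX; apply: (test_measurable tf (X := fun w => X w + y)).
  by apply: random_vectorD => //; exact: random_vector_cst.
- move=> d T X mX; apply: (test_grad_measurable tf (X := fun w => X w + y)).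
  by apply: random_vectorD => //; exact: random_vector_cst.
- by have [c [c0 fc]] := test_bounded tf; exists c; split.
- move=> x a t; have := test_derive tf (x + y) a t.
  rewrite addrAC (_ : (fun s => f (x + y + s *: a)) =
    (fun s => f (x + s *: a + y)))//.
  by apply/funext => s; rewrite addrAC.
- move=> x a; have := test_continuous tf (x + y) a.
  rewrite (_ : (fun t => dot (Df (x + y + t *: a)) a) =
    (fun t => dot (Df (x + t *: a + y)) a))//.
  by apply/funext => s; rewrite addrAC.
Qed.

Lemma test_pullback n q (M : 'M[R]_(q, n)) (f : 'cV[R]_q -> R) Df :
  test_function f Df ->
  test_function (fun x => f (M *m x)) (fun x => M^T *m Df (M *m x)).
Proof.
move=> tf.
(* The chain rule along a line. *)
have dotE x a t : dot (M^T *m Df (M *m (x + t *: a))) a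
    = dot (Df (M *m x + t *: (M *m a))) (M *m a).
  by rewrite /dot trmx_mul trmxK mulmxA mulmxDr scalemxAr.
split.
- move=> d T X mX; apply: (test_measurable tf (X := fun w => M *m X w)).
  exact: random_vector_mulmx.
- move=> d T X mX; apply: random_vector_mulmx.
  apply: (test_grad_measurable tf (X := fun w => M *m X w)).
  exact: random_vector_mulmx.
- have [c [c0 fc]] := test_bounded tf.
  exists (c + \sum_i \sum_j `|M i j| * c); split.
    rewrite addr_ge0// sumr_ge0// => i _; rewrite sumr_ge0// => j _.
    by rewrite mulr_ge0.
  have S0 : 0 <= \sum_i \sum_j `|M i j| * c.
    rewrite sumr_ge0// => i _; rewrite sumr_ge0// => j _.
    by rewrite mulr_ge0.
  move=> x; have [f1 f2] := fc (M *m x); split.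
    by rewrite (le_trans f1)// lerDl.
  move=> j; rewrite mxE; apply: (@le_trans _ _ (\sum_i \sum_j `|M i j| * c)).
    rewrite (le_trans (ler_norm_sum _ _ _))//; apply: ler_sum => i _.
    rewrite normrM mxE (bigD1 j)//=; apply: (@le_trans _ _ (`|M i j| * c)).
      by rewrite ler_wpM2l.
    by rewrite lerDl sumr_ge0// => k _; rewrite mulr_ge0.
  by rewrite lerDr.
- move=> x a t; rewrite dotE.
  have := test_derive tf (M *m x) (M *m a) t.
  rewrite (_ : (fun s => f (M *m x + s *: (M *m a))) =
    (fun s => f (M *m (x + s *: a))))//.
  by apply/funext => s; rewrite mulmxDr scalemxAr.
- move=> x a; under eq_fun do rewrite dotE; exact: (test_continuous tf).
Qed.

Lemma test_mul n (f g : 'cV[R]_n -> R) Df Dg :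
  test_function f Df -> test_function g Dg ->
  test_function (fun x => f x * g x) (fun x => f x *: Dg x + g x *: Df x).
Proof.
move=> tf tg.
have dotE x a : dot (f x *: Dg x + g x *: Df x) a
    = f x * dot (Dg x) a + g x * dot (Df x) a.
  rewrite /dot linearD/= mulmxDl !linearZ/= -!scalemxAl.
  by rewrite mxE; congr (_ + _); rewrite [LHS]mxE.
split.
- move=> d T X mX; by apply: measurable_funM;
    [exact: (test_measurable tf mX) | exact: (test_measurable tg mX)].
- move=> d T X mX; by apply: random_vectorD; apply: random_vectorZ;
    (exact: (test_measurable tf mX) || exact: (test_measurable tg mX) ||
     exact: (test_grad_measurable tf mX) || exact: (test_grad_measurable tg mX)).
- have [c [c0 fc]] := test_bounded tf; have [b [b0 gb]] := test_bounded tg.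
  exists (c * b + b * c); split; first by rewrite addr_ge0// mulr_ge0.
  move=> x; have [f1 f2] := fc x; have [g1 g2] := gb x; split.
    by rewrite normrM (@le_trans _ _ (c * b))// ?ler_pM// lerDl mulr_ge0.
  move=> i; rewrite !mxE (le_trans (ler_normD _ _))// !normrM.
  by rewrite lerD// ler_pM.
- move=> x a t; rewrite dotE; apply: is_deriveM; exact: test_derive.
- move=> x a t; under eq_fun do rewrite dotE.
  have cont h Dh : @test_function n h Dh -> {for t, continuous (fun s : R => h (x + s *: a))}.
    move=> th; apply: differentiable_continuous; apply/derivable1_diffP.
    by have := test_derive th x a t; case.
  by apply: cvgD; apply: cvgM; 
    (exact: (cont _ _ tf) || exact: (cont _ _ tg) ||
     exact: (test_continuous tf) || exact: (test_continuous tg)).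
Qed.

Lemma is_derive_affine (b a t : R) :
  is_derive t 1 (fun s : R => b + s * a) a.
Proof.
have := is_deriveD (is_derive_cst b t 1)
  (is_deriveM (is_derive_id t (1 : R)) (is_derive_cst a t 1)).
move/is_derive_eq; apply.
by rewrite add0r scaler0 add0r /GRing.scale/= mulr1.
Qed.

(** The concrete test functions below are made from functions of one coordinate,
    by products and pullbacks. *)
Lemma test_coord n (l : 'I_n) (h h' : R -> R) c :
  (forall t, `|h t| <= c) -> (forall t, `|h' t| <= c) ->
  (forall t : R, is_derive t 1 h (h' t)) -> continuous h' ->
  test_function (fun x : 'cV[R]_n => h (x l 0))
                (fun x => h' (x l 0) *: delta_mx l 0).
Proof.
move=> hc h'c dh ch'.
have ch : continuous h.
  move=> t; apply: differentiable_continuous; apply/derivable1_diffP.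
  by have := dh t; case.
have c0 : 0 <= c by rewrite (le_trans _ (hc 0))// normr_ge0.
have dotE x a : dot (h' (x l 0) *: delta_mx l 0) a = h' (x l 0) * a l 0.
  rewrite /dot linearZ/= -scalemxAl mxE trmx_delta; congr (_ * _).
  by rewrite -rowE mxE.
split.
- move=> d T X mX; apply: (measurableT_comp (continuous_measurable_fun ch)).
  exact: mX.
- move=> d T X mX; apply: random_vectorZ; last exact: random_vector_cst.
  apply: (measurableT_comp (continuous_measurable_fun ch')); exact: mX.
- exists c; split=> // x; split=> // i.
  by rewrite !mxE andbT; case: eqP => _; rewrite ?mulr1 ?mulr0 ?normr0.
- move=> x a t; rewrite dotE !mxE.
  rewrite (_ : (fun s => h ((x + s *: a) l 0)) =
      h \o (fun s => x l 0 + s * a l 0)); last first.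
    by apply/funext => s; rewrite /= !mxE.
  apply: (@is_derive1_comp _ h (fun s => x l 0 + s * a l 0)) => //.
  exact: is_derive_affine.
- move=> x a; under eq_fun do rewrite dotE !mxE.
  move=> t; apply: cvgM; last exact: cvg_cst.
  apply: (@continuous_comp _ _ _ (fun s : R => x l 0 + s * a l 0) h'); last exact: ch'.
  by apply: cvgD; [exact: cvg_cst | apply: cvgM; [exact: cvg_id|exact: cvg_cst]].
Qed.

End TestFunctions.

(** * Gaussian vectors through the Stein identity *)

Section SteinTerm.
Context {R : realType}.

(** The integrand of the Stein identity. The two occurrences of the random
    vector are separate arguments, [x] for the linear factor and [z] for the test
    function, so that a sum [X + Y] can be split in the first and frozen in the
    second. *)
Definition stein_term {n} (S : 'M[R]_n) (f : 'cV[R]_n -> R)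
    (Df : 'cV[R]_n -> 'cV[R]_n) (i : 'I_n) (x z : 'cV[R]_n) : R :=
  x i 0 * f z - (S *m Df z) i 0.

(** The bound is uniform in [z], hence in all the translations of [f]. *)
Lemma stein_term_bound n (S : 'M[R]_n) f Df i : test_function f Df ->
  exists c, 0 <= c /\
    forall x z, `|stein_term S f Df i x z| <= c * (1 + `|x i 0|).
Proof.
move=> /test_bounded [c [c0 fc]].
have S0 : 0 <= \sum_j `|S i j| by exact: sumr_ge0.
exists (c + (\sum_j `|S i j|) * c); split; first by rewrite addr_ge0// mulr_ge0.
move=> x z; have [f1 f2] := fc z.
have h1 : `|x i 0 * f z| <= c * `|x i 0| by rewrite normrM mulrC ler_wpM2r.
have h2 : `|(S *m Df z) i 0| <= (\sum_j `|S i j|) * c.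
  rewrite mxE (le_trans (ler_norm_sum _ _ _))// mulr_suml ler_sum// => j _.
  by rewrite normrM ler_wpM2l.
rewrite (le_trans (ler_normB _ _))// (le_trans (lerD h1 h2))//.
rewrite mulrDl !mulrDr !mulr1.
have : 0 <= (\sum_j `|S i j|) * c * `|x i 0| by rewrite !mulr_ge0.
move: c0; lra.
Qed.

Lemma measurable_stein_term n (S : 'M[R]_n) f Df i d (T : measurableType d)
    (X Z : T -> 'cV[R]_n) :
  test_function f Df -> random_vector X -> random_vector Z ->
  measurable_fun setT (fun w => stein_term S f Df i (X w) (Z w)).
Proof.
move=> tf mX mZ; apply: measurable_funB.
  by apply: measurable_funM; [exact: mX | exact: (test_measurable tf mZ)].
exact: (random_vector_mulmx S (test_grad_measurable tf mZ)).
Qed.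

End SteinTerm.

Section Gaussian.
Context {d : measure_display} {T : measurableType d} {R : realType}.
Variable P : probability T R.
Implicit Types (F G H : set_system T).

(** [E(Z | F) = 0], without conditional expectations. *)
Definition centered F (Z : T -> R) : Prop :=
  forall A, F A -> (\int[P]_w (\1_A w * Z w)%:E = 0)%E.

Lemma integrable_indicM (A : set T) (Z : T -> R) : measurable A ->
  P.-integrable setT (EFin \o Z) ->
  P.-integrable setT (EFin \o (fun w => \1_A w * Z w)).
Proof.
move=> mA iZ; apply: (le_integrable _ _ _ iZ) => //.
  apply/measurable_EFinP; apply: measurable_funM => //.
  by apply/measurable_EFinP; exact: measurable_int iZ.
move=> w _ /=; rewrite lee_fin normrM indicE.
by case: (_ \in _) => /=; rewrite ?normr1 ?normr0 ?mul1r ?mul0r.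
Qed.

Lemma centered_sum F n (a : 'I_n -> R) (Z : 'I_n -> T -> R) :
  F `<=` measurable -> (forall k, P.-integrable setT (EFin \o Z k)) ->
  (forall k, centered F (Z k)) -> centered F (fun w => \sum_k a k * Z k w).
Proof.
move=> mF iZ cZ A FA.
under eq_integral.
  move=> w _; rewrite mulr_sumr -sumEFin.
  under eq_bigr do rewrite mulrCA EFinM.
  over.
have iAZ k : P.-integrable setT (fun w => (\1_A w * Z k w)%:E).
  by apply: integrable_indicM => //; exact: mF.
rewrite integral_sum//=; last by move=> k; exact: integrableZl.
by rewrite big1// => k _; rewrite integralZl// cZ// mule0.
Qed.

(** The Stein identity, as a substitute for: [X] has law [N(0, S)] and is
    independent of [F]. With [F] reduced to the whole space it only speaks of the
    law of [X]. *)
Record gaussian_given {n} F (X : T -> 'cV[R]_n) (S : 'M[R]_n) : Prop :=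
  GaussianGiven {
  gg_measurable : random_vector X;
  gg_integrable : forall i, P.-integrable setT (EFin \o component X i);
  gg_stein : forall f Df, test_function f Df -> forall i,
    centered F (fun w => stein_term S f Df i (X w) (X w))
}.

Lemma stein_dominator_integrable n (X : T -> 'cV[R]_n) i (c : R) :
  P.-integrable setT (EFin \o component X i) ->
  P.-integrable setT (EFin \o (fun w => c * (1 + `|X w i 0|))).
Proof.
move=> iX; rewrite (_ : _ \o _ =
    (fun w => c%:E * (1%:E + (EFin \o (Num.norm \o component X i)) w))%E)//.
apply: integrableZl => //; apply: integrableD => //; last exact: integrable_norm.
exact: finite_measure_integrable_cst.
Qed.

Lemma stein_term_integrable n (S : 'M[R]_n) f Df i (X Z : T -> 'cV[R]_n) :
  test_function f Df -> random_vector X -> random_vector Z ->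
  P.-integrable setT (EFin \o component X i) ->
  P.-integrable setT (EFin \o (fun w => stein_term S f Df i (X w) (Z w))).
Proof.
move=> tf mX mZ iX; have [c [c0 cP]] := stein_term_bound S i tf.
apply: le_integrable (stein_dominator_integrable c iX) => //.
  by apply/measurable_EFinP; exact: measurable_stein_term.
by move=> w _ /=; rewrite lee_fin (le_trans (cP _ _))// ler_norm.
Qed.

Lemma gaussian_given_sub n F G (X : T -> 'cV[R]_n) S :
  F `<=` G -> gaussian_given G X S -> gaussian_given F X S.
Proof.
move=> FG [mX iX sX]; split=> // f Df tf i A FA.
by apply: (sX f Df tf i); exact: FG.
Qed.

Lemma integrable_component_mulmx n q (M : 'M[R]_(q, n)) (X : T -> 'cV[R]_n) i :
  (forall j, P.-integrable setT (EFin \o component X j)) ->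
  P.-integrable setT (EFin \o component (fun w => M *m X w) i).
Proof.
move=> iX; rewrite (_ : _ \o _ =
    (fun w => \sum_j (M i j)%:E * (EFin \o component X j) w)%E); last first.
  by apply/funext => w; rewrite /= /component mxE -sumEFin.
by apply: integrable_sum => // j _; exact: integrableZl.
Qed.

(** The test function is pulled back along [M], which multiplies its gradient
    by [M^T]. *)
Lemma gaussian_given_mulmx n q F (M : 'M[R]_(q, n)) (X : T -> 'cV[R]_n) S :
  F `<=` measurable -> gaussian_given F X S ->
  gaussian_given F (fun w => M *m X w) (M *m S *m M^T).
Proof.
move=> mF [mX iX sX]; split.
- exact: random_vector_mulmx.
- by move=> i; exact: integrable_component_mulmx.
- move=> f Df tf i.
  have tfM := test_pullback M tf.
  have := @centered_sum F n (fun k => M i k)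
    (fun k w => stein_term S _ _ k (X w) (X w)) mF
    (fun k => stein_term_integrable S tfM mX mX (iX k)) (fun k => sX _ _ tfM k).
  rewrite (_ : (fun w => \sum_k _) =
      (fun w => stein_term (M *m S *m M^T) f Df i (M *m X w) (M *m X w)))//.
  apply/funext => w; rewrite /stein_term -!mulmxA (mxE _ _ i 0).
  rewrite [X in _ = _ - X]mxE mulr_suml -sumrB; apply: eq_bigr => k _.
  by rewrite mulrBr mulrA.
Qed.

Lemma gaussian_given_ae n F (X Y : T -> 'cV[R]_n) S :
  F `<=` measurable -> random_vector Y -> {ae P, forall w, Y w = X w} ->
  gaussian_given F X S -> gaussian_given F Y S.
Proof.
move=> mF mY YX [mX iX sX]; split=> //.
- move=> i; apply/integrableP; split; first by apply/measurable_EFinP; exact: mY.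
  have /integrableP[_] := iX i.
  rewrite (@ae_eq_integral _ _ _ P setT (fun w => `|(EFin \o component Y i) w|%E)
    (fun w => `|(EFin \o component X i) w|%E))//.
  + by apply: measurableT_comp => //; apply/measurable_EFinP; exact: mX.
  + by apply: measurableT_comp => //; apply/measurable_EFinP; exact: mY.
  + by apply: filterS YX => w YXw _; rewrite /= /component YXw.
- move=> f Df tf i A FA; rewrite -(sX f Df tf i A FA).
  have mst (Z : T -> 'cV[R]_n) : random_vector Z ->
      measurable_fun setT (fun w => (\1_A w * stein_term S f Df i (Z w) (Z w))%:E).
    move=> mZ; apply/measurable_EFinP; apply: measurable_funM.
      by apply: measurable_indic; exact: mF.
    exact: measurable_stein_term.
  apply: ae_eq_integral => //; [exact: mst | exact: mst |].
  by apply: filterS YX => w YXw _; rewrite /= YXw.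
Qed.

End Gaussian.

(** * Sums of independent Gaussian vectors *)

Section GaussianAdd.
Context {d : measure_display} {T : measurableType d} {R : realType}.
Variable P : probability T R.
Implicit Types (F G H : set_system T).

Lemma vec_measurable_wrtP n F (X : T -> 'cV[R]_n) : sigma_algebra setT F ->
  vec_measurable_wrt F X <->
  random_vector (X : g_sigma_algebraType F -> 'cV[R]_n).
Proof. by move=> sF; split=> mX i; apply/(measurable_wrtP _ sF); exact: mX. Qed.

Lemma vec_measurable_wrt_ambient n F (X : T -> 'cV[R]_n) :
  F `<=` measurable -> vec_measurable_wrt F X -> random_vector X.
Proof. by move=> mF mX i; apply: measurable_wrt_ambient mF _; exact: mX. Qed.

Lemma measurable_wrt_indic F A : sigma_algebra setT F -> F A ->
  measurable_wrt F (\1_A : T -> R).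
Proof.
move=> sF FA; apply/(measurable_wrtP _ sF); apply: measurable_indic.
by rewrite measurable_g_measurableTypeE.
Qed.

(** Conditioning on the second of two independent vectors only translates the
    test function: this is half of the stability of the Stein identity under
    independent sums. *)
Lemma stein_convolution n H1 H2 (A1 A2 : set T) (X Y : T -> 'cV[R]_n) S f Df i :
  sigma_algebra setT H1 -> sigma_algebra setT H2 ->
  H1 `<=` measurable -> H2 `<=` measurable -> independent2 P H1 H2 ->
  vec_measurable_wrt H1 X -> vec_measurable_wrt H2 Y -> H1 A1 -> H2 A2 ->
  P.-integrable setT (EFin \o component X i) -> test_function f Df ->
  (forall y,
    (\int[P]_w (\1_A1 w * stein_term S f Df i (X w) (X w + y))%:E = 0)%E) ->
  (\int[P]_w (\1_A1 w * \1_A2 w * stein_term S f Df i (X w) (X w + Y w))%:E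
   = 0)%E.
Proof.
move=> s1 s2 m1 m2 H12 X1 Y2 HA1 HA2 iX tf sX.
have [c [c0 cP]] := stein_term_bound S i tf.
have rX := (vec_measurable_wrtP X s1).1 X1.
have rY := (vec_measurable_wrtP Y s2).1 Y2.
pose T1 := g_sigma_algebraType H1; pose T2 := g_sigma_algebraType H2.
pose Phi (z : T1 * T2) := \1_A1 z.1 * \1_A2 z.2 *
  stein_term S f Df i (X z.1) (X z.1 + Y z.2) : R.
have r1 : random_vector (fun z : T1 * T2 => X z.1).
  by move=> j; exact: (measurableT_comp (rX j) measurable_fst).
have r2 : random_vector (fun z : T1 * T2 => Y z.2).
  by move=> j; exact: (measurableT_comp (rY j) measurable_snd).
have mi1 := (measurable_wrtP _ s1).1 (measurable_wrt_indic s1 HA1).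
have mi2 := (measurable_wrtP _ s2).1 (measurable_wrt_indic s2 HA2).
have ind01 (A : set T) w : 0 <= (\1_A w : R) <= 1.
  by rewrite indicE; case: (_ \in _) => /=; rewrite ?ler01 ?lexx.
apply: (@integral_decouple_eq0 _ _ _ P H1 H2 Phi
  (fun w => c * (1 + `|X w i 0|))) => //.
- apply: measurable_funM; first apply: measurable_funM.
  + exact: (measurableT_comp mi1 measurable_fst).
  + exact: (measurableT_comp mi2 measurable_snd).
  + by apply: measurable_stein_term => //; exact: random_vectorD.
- apply/(measurable_wrtP _ s1); apply: measurable_funM => //.
  apply: measurable_funD => //; apply: measurableT_comp => //; exact: rX.
- exact: stein_dominator_integrable.
- move=> w w'; rewrite /Phi/= !normrM -[leRHS]mul1r ler_pM//.
  rewrite -[leRHS]mul1r; have /andP[? ?] := ind01 A1 w.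
  by have /andP[? ?] := ind01 A2 w'; rewrite !ger0_norm// ler_pM.
- move=> w'; rewrite /Phi/=; have := sX (Y w') => sXY.
  under eq_integral do rewrite (mulrC (\1_A1 _)) -mulrA EFinM.
  rewrite integralZl//= ?sXY ?mule0//.
  apply: integrable_indicM; first exact: m1.
  apply: stein_term_integrable => //; first exact: vec_measurable_wrt_ambient X1.
  apply: random_vectorD; first exact: vec_measurable_wrt_ambient X1.
  exact: random_vector_cst.
Qed.

(** The linear factor [X + Y] is split. In each half the other vector is frozen,
    which leaves the Stein identity of one vector against a translated test
    function, and the two covariance terms add up. *)
Lemma gaussian_given_add n F H1 H2 (X Y : T -> 'cV[R]_n) S S' :
  sigma_algebra setT H1 -> sigma_algebra setT H2 ->
  H1 `<=` measurable -> H2 `<=` measurable -> independent2 P H1 H2 ->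
  F `<=` H1 -> vec_measurable_wrt H1 X -> vec_measurable_wrt H2 Y ->
  gaussian_given P F X S -> gaussian_given P [set setT] Y S' ->
  gaussian_given P F (fun w => X w + Y w) (S + S').
Proof.
move=> s1 s2 m1 m2 H12 FH1 X1 Y2 gX gY.
have mX := gg_measurable gX; have mY := gg_measurable gY.
have iX := gg_integrable gX; have iY := gg_integrable gY.
have mXY := random_vectorD mX mY.
have HT H : sigma_algebra setT H -> H setT.
  by move=> /sigma_algebra_dynkin /dynkinT.
split=> //.
- move=> i; rewrite (_ : _ \o _ =
    (fun w => (EFin \o component X i) w + (EFin \o component Y i) w)%E).
    exact: integrableD.
  by apply/funext => w; rewrite /= /component mxE EFinD.
- move=> f Df tf i B FB.
  have mB : measurable B by exact/m1/FH1.
  have eX : (\int[P]_w (\1_B w * \1_setT w *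
      stein_term S f Df i (X w) (X w + Y w))%:E = 0)%E.
    apply: (stein_convolution s1 s2) => //; [exact: FH1 | exact: HT |].
    by move=> y; exact: (gg_stein gX (test_translate y tf) i FB).
  have eY : (\int[P]_w (\1_setT w * \1_B w *
      stein_term S' f Df i (Y w) (Y w + X w))%:E = 0)%E.
    apply: (stein_convolution s2 s1) => //; [|exact: HT | exact: FH1 |].
      exact: independent2_sym.
    by move=> y; exact: (gg_stein gY (test_translate y tf) i erefl).
  have i1 : P.-integrable setT (EFin \o (fun w => \1_B w * \1_setT w *
      stein_term S f Df i (X w) (X w + Y w))).
    under eq_fun do rewrite indicT mulr1.
    by apply: integrable_indicM => //; exact: stein_term_integrable.
  have i2 : P.-integrable setT (EFin \o (fun w => \1_setT w * \1_B w *
      stein_term S' f Df i (Y w) (Y w + X w))).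
    under eq_fun do rewrite indicT mul1r.
    apply: integrable_indicM => //; apply: stein_term_integrable => //.
    exact: random_vectorD.
  rewrite -[RHS](adde0 (0 : \bar R)) -{1}eX -eY -integralD//=.
  apply: eq_integral => w _; rewrite -EFinD indicT mulr1 mul1r; congr (_%:E).
  rewrite -mulrDr (addrC (Y w)) /stein_term mulmxDl !mxE; ring.
Qed.

End GaussianAdd.

(** * The standard normal law *)

Section NormalLaw.
Context {R : realType}.
Local Notation mu := (@lebesgue_measure R).
Local Notation phi := (@normal_pdf R 0 1).
Local Notation N01 := (@normal_prob R 0 1).

(** The density is a Radon-Nikodym derivative, by uniqueness of the latter. *)
Lemma ge0_integral_normal_prob (f : R -> \bar R) :
  (forall x, 0 <= f x)%E -> measurable_fun setT f ->
  (\int[N01]_x f x = \int[mu]_x (f x * (phi x)%:E))%E.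
Proof.
move=> f0 mf; have dom := @normal_prob_dominates R 0 1.
rewrite -(Radon_Nikodym_SigmaFinite.change_of_variables dom)//.
have mRN : measurable_fun setT (Radon_Nikodym_SigmaFinite.f N01 mu).
  exact: measurable_int (Radon_Nikodym_SigmaFinite.f_integrable dom).
have mpdf : measurable_fun setT (EFin \o phi).
  by apply/measurable_EFinP; exact: measurable_normal_pdf.
apply: ae_eq_integral => //; [exact: emeasurable_funM.. |].
apply: ae_eqe_mul2l; apply: integral_ae_eq => //.
- exact: Radon_Nikodym_SigmaFinite.f_integrable.
- by move=> E _ mE; rewrite -Radon_Nikodym_SigmaFinite.f_integral.
Qed.

Lemma integral_normal_prob (f : R -> R) :
  measurable_fun setT f ->
  N01.-integrable setT (EFin \o f) ->
  (\int[N01]_x (f x)%:E = \int[mu]_x (f x * phi x)%:E)%E.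
Proof.
move=> mf intf; have dom := @normal_prob_dominates R 0 1.
rewrite -(Radon_Nikodym_change_of_variables dom)//=.
under [RHS]eq_integral do rewrite EFinM.
have mEf : measurable_fun setT (EFin \o f) by exact/measurable_EFinP.
have mpdf : measurable_fun setT (EFin \o phi).
  by apply/measurable_EFinP; exact: measurable_normal_pdf.
apply: ae_eq_integral => //.
- apply: emeasurable_funM; first exact: mEf.
  apply: (measurable_int mu).
  by apply: Radon_Nikodym_integrable; exact: dom.
- exact: emeasurable_funM.
- apply: ae_eqe_mul2l => /=; rewrite Radon_NikodymE//=.
  case: cid => /= h [_ ih hE].
  by apply: integral_ae_eq => // E _ mE; rewrite -hE.
Qed.

(** The tail bound [`|x| exp (- x ^ 2 / 2) <= exp (- x ^ 2 / 4)] dominates the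
    first absolute moment by another Gaussian density. *)
Lemma normal_fun_moment (x : R) :
  `|x| * normal_fun 0 1 x <= normal_fun 0 (Num.sqrt 2) x.
Proof.
rewrite /normal_fun subr0 expr1n sqr_sqrtr// (_ : - x ^+ 2 / (1 *+ 2) =
    - x ^+ 2 / (2 *+ 2) - x ^+ 2 / 4); last by field.
rewrite expRD mulrCA ler_piMr ?expR_ge0// expRN ler_pdivrMr ?expR_gt0// mul1r.
apply: le_trans (expR_ge1Dx _).
have := sqr_ge0 (`|x| / 2 - 1); rewrite -(real_normK (num_real x)).
by move: (`|x|) => y; nra.
Qed.

Lemma normal_pdf_moment_integrable :
  mu.-integrable setT (fun x => (`|x| * phi x)%:E).
Proof.
have s2 : Num.sqrt 2 != 0 :> R by rewrite gt_eqF// sqrtr_gt0.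
pose c := normal_peak 1 / normal_peak (Num.sqrt 2 : R).
apply: (@le_integrable _ _ _ mu setT measurableT _
  (fun x => c%:E * (normal_pdf 0 (Num.sqrt 2) x)%:E)%E).
- apply/measurable_EFinP; apply: measurable_funM; last exact: measurable_normal_pdf.
  exact: normr_measurable.
- move=> x _; rewrite -EFinM !abse_EFin lee_fin normrM normr_id [leRHS]normrM.
  have p1 : 0 < normal_peak 1 :> R by rewrite normal_peak_gt0// oner_neq0.
  have p2 : 0 < normal_peak (Num.sqrt 2) :> R by rewrite normal_peak_gt0.
  have c0 : 0 <= c by rewrite divr_ge0// ltW.
  rewrite (ger0_norm c0) (ger0_norm (normal_pdf_ge0 0 1 x)).
  rewrite (ger0_norm (normal_pdf_ge0 0 (Num.sqrt 2) x)).
  rewrite !normal_pdfE ?oner_neq0// mulrCA -mulrA mulKf ?gt_eqF//.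
  by rewrite ler_pM2l// normal_fun_moment.
- by apply: integrableZl => //; exact: integrable_normal_pdf.
Qed.

Lemma normal_prob_id_integrable : N01.-integrable setT (EFin \o id).
Proof.
apply/integrableP; split; first exact/measurable_EFinP.
rewrite ge0_integral_normal_prob//; last first.
  by apply: measurableT_comp => //; apply: measurableT_comp.
under eq_integral do rewrite /= -EFinM.
exact: integrable_lty normal_pdf_moment_integrable.
Qed.

Lemma is_derive_normal_pdf (x : R) : is_derive x 1 phi (- x * phi x).
Proof.
rewrite normal_pdfE ?oner_neq0//.
have -> : (fun x : R => normal_peak 1 * normal_fun 0 1 x) =
    (fun x : R => normal_peak 1 *: expR (x * (- 2^-1 * x))).
  apply/funext => y; rewrite /normal_fun subr0 expr1n; congr (_ * expR _).
  by field.
have h : is_derive x 1 (fun y : R => y * (- 2^-1 * y)) (- x).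
  have := is_deriveM (is_derive_id x (1 : R))
    (is_deriveZ (- 2^-1) (is_derive_id x (1 : R))).
  move/is_derive_eq; apply; rewrite /GRing.scale/=; rewrite -[_ *: x]/(- 2^-1 * x). by field.
have := is_deriveZ (normal_peak 1) 
  (@is_derive1_comp _ expR (fun y : R => y * (- 2^-1 * y)) x _ _
    (is_derive_expR _) h).
move/is_derive_eq; apply; rewrite /normal_fun subr0 expr1n.
rewrite (_ : - x ^+ 2 / (1 *+ 2) = x * (- 2^-1 * x)); last by field.
by rewrite /GRing.scale/= (mulrC _ (- x)) mulrCA.
Qed.

End NormalLaw.

Section SteinNormal.
Context {R : realType}.
Local Notation mu := (@lebesgue_measure R).
Local Notation phi := (@normal_pdf R 0 1).
Local Notation N01 := (@normal_prob R 0 1).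

Lemma is_derive_continuous (h : R -> R) (x l : R) :
  is_derive x 1 h l -> {for x, continuous h}.
Proof.
by move=> dh; apply: differentiable_continuous; apply/derivable1_diffP; case: dh.
Qed.

(** The boundary terms of the integration by parts are of order [1 / x]. *)
Lemma normal_pdf_decay (x : R) : `|x| * phi x <= normal_peak 1.
Proof.
rewrite normal_pdfE ?oner_neq0// mulrCA -[leRHS]mulr1 ler_wpM2l ?normal_peak_ge0//.
apply: le_trans (normal_fun_moment x) _.
rewrite /normal_fun subr0 -[leRHS]expR0 ler_expR mulNr oppr_le0.
by rewrite mulr_ge0 ?sqr_ge0// invr_ge0 mulrn_wge0 ?sqr_ge0.
Qed.

(** The integrand times the density is the derivative of [- h phi], because
    [phi' x = - x phi x]. *)
Lemma stein_normal (h h' : R -> R) (c : R) :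
  (forall x, `|h x| <= c) -> (forall x, `|h' x| <= c) ->
  (forall x : R, is_derive x 1 h (h' x)) -> continuous h' ->
  [/\ measurable_fun setT (fun x : R => x * h x - h' x),
      N01.-integrable setT (fun x : R => (x * h x - h' x)%:E)
    & (\int[N01]_x (x * h x - h' x)%:E = 0)%E].
Proof.
move=> hc h'c dh ch'; pose g x := x * h x - h' x.
have c0 : 0 <= c by rewrite (le_trans _ (hc 0))// normr_ge0.
have ch : continuous h by move=> x; exact: is_derive_continuous (dh x).
have cg : continuous g.
  by move=> x; apply: cvgB; [apply: cvgM; [exact: cvg_id | exact: ch] | exact: ch'].
have cphi : continuous phi by apply: continuous_normal_pdf; exact: oner_neq0.
have mg : measurable_fun setT g by exact: continuous_measurable_fun.
have mphi := @measurable_normal_pdf R 0 1.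
have gc x : `|g x| <= c * (1 + `|x|).
  rewrite /g (le_trans (ler_normB _ _))// normrM mulrDr mulr1 addrC lerD//.
  by rewrite mulrC ler_wpM2r.
have phi0 x : 0 <= phi x by exact: normal_pdf_ge0.
have iG : mu.-integrable setT (fun x => (c * (1 + `|x|) * phi x)%:E).
  rewrite (_ : (fun x => _) =
      (fun x => c%:E * ((phi x)%:E + (`|x| * phi x)%:E))%E); last first.
    by apply/funext => x; rewrite -EFinD -EFinM; congr (_%:E); ring.
  apply: integrableZl => //; apply: integrableD => //.
    exact: integrable_normal_pdf.
  exact: normal_pdf_moment_integrable.
have ig : mu.-integrable setT (fun x => (g x * phi x)%:E).
  apply: le_integrable iG => //; first by apply/measurable_EFinP; exact: measurable_funM.
  move=> x _; rewrite !abse_EFin lee_fin !normrM ler_wpM2r// (le_trans (gc x))//.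
  by rewrite -normrM ler_norm.
have igN : N01.-integrable setT (EFin \o g).
  have iN : N01.-integrable setT (fun x => (c%:E * (1%:E + (`|x|)%:E))%E).
    apply: integrableZl => //; apply: integrableD => //.
      exact: (finite_measure_integrable_cst _ 1).
    exact: (integrable_norm normal_prob_id_integrable).
  apply: le_integrable iN => //; first exact/measurable_EFinP.
  by move=> x _; rewrite -EFinD -EFinM !abse_EFin lee_fin (le_trans (gc x))// ler_norm.
split=> //; rewrite -[LHS]/(\int[N01]_x (g x)%:E)%E integral_normal_prob//.
pose F x := - (h x * phi x).
have dF (x : R) : is_derive x 1 F (g x * phi x).
  have := is_deriveN (is_deriveM (dh x) (is_derive_normal_pdf x)).
  by move/is_derive_eq; apply; rewrite /GRing.scale/= /g; ring.
have Fx x : `|x| * `|F x| <= c * normal_peak 1.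
  rewrite /F normrN normrM mulrCA (ger0_norm (phi0 x)).
  by apply: ler_pM => //; [exact: mulr_ge0 | exact: normal_pdf_decay].
pose D n : set R := [set` `[- n.+1%:R, n.+1%:R : R]].
pose r n := F n.+1%:R - F (- n.+1%:R).
have intD n : (\int[mu]_(x in D n) (g x * phi x)%:E = (r n)%:E)%E.
  rewrite /D /r EFinB; apply: continuous_FTC2.
  - by rewrite ltrNl (@lt_trans _ _ 0)// ?oppr_lt0.
  - by apply: continuous_subspaceT => x; apply: cvgM; [exact: cg | exact: cphi].
  - split.
    + by move=> x _; case: (dF x).
    + by apply: cvg_at_right_filter; exact: is_derive_continuous (dF _).
    + by apply: cvg_at_left_filter; exact: is_derive_continuous (dF _).
  - by move=> x _; rewrite derive1E; exact: derive_val.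
have r0 : r n @[n --> \oo] --> 0.
  have bound n : `|r n| <= (c * normal_peak 1 *+ 2) * harmonic n.
    have n0 : 0 < n.+1%:R :> R by [].
    rewrite /r /harmonic/= ler_pdivlMr// mulr2n (le_trans (ler_wpM2r _ (ler_normB _ _)))//.
    rewrite mulrDl lerD// mulrC.
      by have := Fx n.+1%:R; rewrite ger0_norm.
    by have := Fx (- n.+1%:R); rewrite normrN ger0_norm.
  apply: norm_cvg0; apply: (squeeze_cvgr (f := fun=> 0)
    (h := fun n => (c * normal_peak 1 *+ 2) * harmonic n)).
  - by apply: nearW => n; rewrite normr_ge0 bound.
  - exact: cvg_cst.
  - rewrite -[X in _ --> X](mulr0 (c * normal_peak 1 *+ 2)).
    by apply: cvgM; [exact: cvg_cst | exact: cvg_harmonic].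
have mD n : measurable (D n) by exact: measurable_itv.
case: (@dominated_convergence _ _ _ mu setT measurableT
  (fun n x => (g x * phi x)%:E * (\1_(D n) x)%:E)%E
  (fun x => (g x * phi x)%:E) (fun x => `|(g x * phi x)%:E|)%E).
- by move=> n; apply: emeasurable_funM; [exact: (measurable_int mu ig) |
    apply/measurable_EFinP; apply: measurable_indic; exact: mD].
- exact: (measurable_int mu ig).
- apply: aeW => x _.
  apply: cvg_near_cst; near=> n.
  rewrite indicE mem_set ?mule1// /D /mkset in_itv/= -ler_norml.
  rewrite (@le_trans _ _ n%:R)// ?ler_nat//.
  near: n; exact: nbhs_infty_ger.
- exact: integrable_abse.
- apply: aeW => x n _; rewrite abseM -[leRHS]mule1 lee_wpmul2l//.
  by rewrite abse_EFin lee_fin indicE; case: (_ \in _); rewrite /= ?normr1 ?normr0.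
move=> _ _ lim; apply: (cvg_unique _ lim); first exact: ereal_hausdorff.
rewrite (_ : [sequence _]_n = EFin \o r); last first.
  apply/funext => n /=; rewrite -intD [RHS]integral_mkcond.
  by apply: eq_integral => x _; rewrite epatch_indic.
by apply/cvg_EFin; [exact: nearW | exact: r0].
Unshelve. all: by end_near. Qed.

End SteinNormal.

Section StandardNormal.
Context {d : measure_display} {T : measurableType d} {R : realType}.
Variable P : probability T R.
Local Notation N01 := (@normal_prob R 0 1).

Section Law.
Variable X : T -> R.
Hypothesis mX : measurable_fun setT X.
Hypothesis lawX : forall B : set R, measurable B -> P (X @^-1` B) = normal_prob 0 1 B.

Let mXR : measurable_fun setT (X : T -> measurableTypeR R).
Proof. exact: mX. Qed.

Lemma ge0_integral_normal_law (f : R -> \bar R) :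
  (forall x, 0 <= f x)%E -> measurable_fun setT f ->
  (\int[P]_w f (X w) = \int[N01]_x f x)%E.
Proof.
move=> f0 mf.
pose X' : {mfun T >-> measurableTypeR R} :=
  HB.pack (X : T -> measurableTypeR R) (isMeasurableFun.Build _ _ _ _ _ mXR).
rewrite -[LHS]/(\int[P]_w (f \o X') w)%E -ge0_integral_distribution//.
by apply: eq_measure_integral => A mA _; exact: lawX.
Qed.

Lemma normal_law_integrable (f : R -> R) : measurable_fun setT f ->
  N01.-integrable setT (EFin \o f) -> P.-integrable setT (EFin \o (f \o X)).
Proof.
move=> mf /integrableP[_ intf]; apply/integrableP; split.
  by apply/measurable_EFinP; exact: measurableT_comp.
rewrite -[X in (X < _)%E]/(\int[P]_w (abse \o (EFin \o f)) (X w))%E.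
rewrite ge0_integral_normal_law//; first by move=> x; exact: abse_ge0.
by apply: measurableT_comp => //; exact/measurable_EFinP.
Qed.

Lemma integral_normal_law (f : R -> R) : measurable_fun setT f ->
  N01.-integrable setT (EFin \o f) ->
  (\int[P]_w (f (X w))%:E = \int[N01]_x (f x)%:E)%E.
Proof.
move=> mf intf.
pose X' : {mfun T >-> measurableTypeR R} :=
  HB.pack (X : T -> measurableTypeR R) (isMeasurableFun.Build _ _ _ _ _ mXR).
transitivity (\int[distribution P X']_y (f y)%:E)%E.
  apply/esym; apply: integral_distribution; first exact/measurable_EFinP.
  exact: normal_law_integrable.
by apply: eq_measure_integral => A mA _; exact: lawX.
Qed.

End Law.

(** Coordinate by coordinate: given the other coordinates, [f] is a function of
    the [i]-th one along a line. *)
Lemma standard_normal_gaussian r (G : T -> 'cV[R]_r) :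
  standard_normal_vector P G -> gaussian_given P [set setT] G 1%:M.
Proof.
move=> [mG lawG indG].
have iG i : P.-integrable setT (EFin \o component G i).
  apply: (@normal_law_integrable (component G i) _ _ id) => //.
    exact: lawG.
  exact: normal_prob_id_integrable.
split=> // f Df tf i _ ->.
pose F (j : 'I_r) := @sigma_of R T [set component G j].
have sF j : sigma_algebra setT (F j) by exact: sigma_of_algebra.
have mF j : F j `<=` measurable.
  apply: sigma_of_sub; first exact: sigma_algebra_measurable.
  by move=> _ ->; apply: measurable_wrt_measurable; exact: mG.
pose H1 := family_algebra F [set i]; pose H2 := family_algebra F (~` [set i]).
have H12 : independent2 P H1 H2.
  by apply: mutually_independent_split => //; rewrite setICr.
have s1 : sigma_algebra setT H1 by exact: family_algebraP.
have s2 : sigma_algebra setT H2 by exact: family_algebraP.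
have m1 : H1 `<=` measurable by exact: family_algebra_measurable.
have m2 : H2 `<=` measurable by exact: family_algebra_measurable.
(* All the coordinates but the [i]-th, which depend on the other sources only. *)
pose y w : 'cV[R]_r := \col_j (if j == i then 0 else G w j 0).
pose e : 'cV[R]_r := delta_mx i 0.
have Ge w : G w = y w + G w i 0 *: e.
  apply/colP => j; rewrite !mxE andbT; case: eqP => [->|_].
    by rewrite mulr1 add0r.
  by rewrite mulr0 addr0.
have FJ (J : set 'I_r) j : J j ->
    measurable_wrt (family_algebra F J) (component G j).
  move=> Jj; apply: (@measurable_wrt_sub _ _ _ (F j)).
    exact: family_algebra_sub.
  exact: sigma_of_measurable.
have Gi1 : measurable_wrt H1 (component G i) by exact: FJ.
have y2 : vec_measurable_wrt H2 y.
  move=> j; have [->|ji] := eqVneq j i.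
    apply/(measurable_wrtP _ s2); rewrite (_ : component y i = cst 0)//.
    by apply/funext => w; rewrite /component mxE eqxx.
  rewrite (_ : component y j = component G j); last first.
    by apply/funext => w; rewrite /component mxE (negbTE ji).
  by apply: FJ; exact/eqP.
have [c [c0 cP]] := stein_term_bound 1%:M i tf.
have rGi := (measurable_wrtP _ s1).1 Gi1.
have ry := (vec_measurable_wrtP y s2).1 y2.
pose T1 := g_sigma_algebraType H1; pose T2 := g_sigma_algebraType H2.
have r1 : random_vector (fun z : T1 * T2 => component G i z.1 *: e).
  apply: random_vectorZ; last exact: random_vector_cst.
  exact: (measurableT_comp rGi measurable_fst).
have r2 : random_vector (fun z : T1 * T2 => y z.2).
  by move=> j; exact: (measurableT_comp (ry j) measurable_snd).
have ei : e i 0 = 1 by rewrite mxE !eqxx.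
transitivity (\int[P]_w (stein_term 1%:M f Df i
    (component G i w *: e) (y w + component G i w *: e))%:E)%E.
  apply: eq_integral => w _; rewrite indicT mul1r -Ge.
  by rewrite /stein_term [in RHS]mxE ei mulr1.
apply: (@integral_decouple_eq0 _ _ _ P H1 H2 (fun z : T1 * T2 =>
  stein_term 1%:M f Df i (component G i z.1 *: e)
    (y z.2 + component G i z.1 *: e)) (fun w => c * (1 + `|component G i w|)))
  => //.
- by apply: measurable_stein_term => //; exact: random_vectorD.
- apply/(measurable_wrtP _ s1); apply: measurable_funM => //.
  by apply: measurable_funD => //; exact: measurableT_comp.
- exact: stein_dominator_integrable.
- by move=> w w'; rewrite (le_trans (cP _ _))// mxE ei mulr1.
- move=> w'; have [b [b0 bP]] := test_bounded tf.
  pose h t := f (y w' + t *: e); pose h' t := Df (y w' + t *: e) i 0.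
  have dote a : dot a e = a i 0.
    by rewrite /dot -colE !mxE.
  have dh (t : R) : is_derive t 1 h (h' t).
    by rewrite /h' -dote; exact: (test_derive tf).
  have ch' : continuous h'.
    rewrite (_ : h' = fun t => dot (Df (y w' + t *: e)) e).
      exact: (test_continuous tf).
    by apply/funext => t; rewrite dote.
  have [||mh ih h0] := @stein_normal R h h' b _ _ dh ch'.
  + by move=> t; have [] := bP (y w' + t *: e).
  + by move=> t; have [_] := bP (y w' + t *: e); apply.
  rewrite -h0 -(@integral_normal_law (component G i) _ _ (fun t => t * h t - h' t))//.
    apply: eq_integral => w _; rewrite /stein_term mxE ei mulr1 mul1mx.
    by rewrite /h /h'.
  exact: lawG.
Qed.

(** The Stein identity only sees the law of [X]. This matters because the
    standard normal vectors that represent independent Gaussian vectors need not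
    be independent of each other. *)
Lemma gaussian_vector_given n (X : T -> 'cV[R]_n) (S : 'M[R]_n) :
  gaussian_vector P X 0 S -> gaussian_given P [set setT] X S.
Proof.
move=> [mX [r [M [G [stdG <- XE]]]]].
have mT : [set setT] `<=` @measurable _ T by move=> _ ->.
apply: (gaussian_given_ae mT mX (X := fun w => M *m G w)).
  by apply: filterS XE => w ->; rewrite add0r.
have := gaussian_given_mulmx M mT (standard_normal_gaussian stdG).
by rewrite mulmx1.
Qed.

Lemma gaussian_vector_gram n (X : T -> 'cV[R]_n) (mean : 'cV[R]_n)
    (S : 'M[R]_n) :
  gaussian_vector P X mean S -> exists r (M : 'M[R]_(n, r)), S = M *m M^T.
Proof. by move=> [_ [r [M [G [_ <- _]]]]]; exists r, M. Qed.

End StandardNormal.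

(** * Smooth approximations of half-spaces *)

Section Sigmoid.
Context {R : realType}.

Definition sigmoid (t : R) : R := (1 + expR (- t))^-1.
Definition sigmoid' (t : R) : R := expR (- t) / (1 + expR (- t)) ^+ 2.

Lemma sigmoid_den_gt0 (t : R) : 0 < 1 + expR (- t).
Proof. by rewrite addr_gt0// expR_gt0. Qed.

Lemma sigmoid_bound (t : R) : 0 <= sigmoid t <= 1.
Proof.
rewrite /sigmoid invr_ge0 ltW ?sigmoid_den_gt0//= invf_le1 ?sigmoid_den_gt0//.
by rewrite lerDl expR_ge0.
Qed.

Lemma sigmoid'_bound (t : R) : `|sigmoid' t| <= 1.
Proof.
have e0 := expR_gt0 (- t); rewrite /sigmoid' ger0_norm; last first.
  by rewrite divr_ge0 ?sqr_ge0// ltW.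
by rewrite ler_pdivrMr ?exprn_gt0 ?sigmoid_den_gt0// mul1r; nra.
Qed.

Lemma is_derive_sigmoid (t : R) : is_derive t 1 sigmoid (sigmoid' t).
Proof.
have d1 : is_derive t 1 (fun s : R => expR (- s)) (- expR (- t)).
  have := @is_derive1_comp _ expR -%R t _ _ (is_derive_expR _) (is_deriveNid t 1).
  by rewrite mulrN1.
have d2 := is_deriveD (is_derive_cst (1 : R) t 1) d1.
have d3 := is_deriveV (f := fun s : R => 1 + expR (- s)) _ d2.
apply: (is_derive_eq (d3 _)); rewrite ?gt_eqF ?sigmoid_den_gt0//.
by rewrite /sigmoid' add0r /GRing.scale/= mulNr mulrN opprK mulrC.
Qed.

Lemma continuous_sigmoid' : continuous sigmoid'.
Proof.
have ce : continuous (fun s : R => expR (- s)).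
  move=> t; apply: (@continuous_comp _ _ _ -%R expR).
    exact: opp_continuous.
  exact: continuous_expR.
move=> t; apply: cvgM; first exact: ce.
apply: cvgV; first by rewrite expf_neq0// gt_eqF// sigmoid_den_gt0.
apply: (cvg_comp _ (fun x : R => x ^+ 2)); last exact: sqr_continuous.
by apply: cvgD; [exact: cvg_cst | exact: ce].
Qed.

(** [step_approx a m] is a smooth approximation of the indicator of [{y | a < y}];
    the shift by [m] makes it converge to 0 at the jump too. *)
Definition step_approx (a : R) (m : nat) (y : R) : R :=
  sigmoid (- (m%:R ^+ 2 * a + m%:R) + y * m%:R ^+ 2).

Lemma sigmoid_lower (t : R) : 0 <= t -> 1 - sigmoid t <= (1 + t)^-1.
Proof.
move=> t0; rewrite /sigmoid -{1}(divff (x := 1 + expR (- t))); last first.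
  by rewrite gt_eqF// sigmoid_den_gt0.
rewrite -[X in _ - X]mul1r -mulrBl addrC addKr expRN.
have e1 := expR_ge1Dx t.
apply: (@le_trans _ _ (expR t)^-1).
  rewrite ler_piMr ?invr_ge0 ?expR_ge0// invf_le1; last first.
    by rewrite addr_gt0// invr_gt0 expR_gt0.
  by rewrite lerDl invr_ge0 expR_ge0.
by rewrite lef_pV2// posrE ?expR_gt0// ltr_pwDl.
Qed.

Lemma sigmoid_upper (t : R) : 0 <= t -> sigmoid (- t) <= (1 + t)^-1.
Proof.
move=> t0; rewrite /sigmoid opprK lef_pV2 ?posrE.
- by rewrite (le_trans (expR_ge1Dx t))// lerDr.
- by rewrite addr_gt0// expR_gt0.
- by rewrite ltr_pwDl.
Qed.

Lemma step_approx_cvg (a y : R) :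
  step_approx a m y @[m --> \oo] --> ((a < y)%R%:R : R).
Proof.
have h0 : harmonic m @[m --> \oo] --> (0 : R) by exact: cvg_harmonic.
have arg m : - (m%:R ^+ 2 * a + m%:R) + y * m%:R ^+ 2
    = m%:R ^+ 2 * (y - a) - m%:R by ring.
have [ay|ya] := ltP a y.
- apply: (@squeeze_cvgr _ _ _ _ (fun m => 1 - harmonic m) (fun=> 1)).
  + near=> m; rewrite /step_approx arg.
    set t := (X in sigmoid X).
    have tm : m%:R <= t.
      have d2 : 2 <= m%:R * (y - a).
        rewrite -ler_pdivrMr ?subr_gt0//.
        by near: m; exact: nbhs_infty_ger.
      have : 0 <= m%:R * (m%:R * (y - a) - 2) by rewrite mulr_ge0// subr_ge0.
      by rewrite /t; lra.
    have t0 : 0 <= t by rewrite (le_trans _ tm).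
    have /andP[_ ->] := sigmoid_bound t; rewrite andbT lerBlDr -lerBlDl.
    apply: (le_trans (sigmoid_lower t0)).
    by rewrite /harmonic/= lef_pV2 ?posrE ?ltr_pwDl// -natr1 [leRHS]addrC lerD2r.
  + rewrite -[X in _ --> X](subr0 (1 : R)).
    by apply: cvgB; [exact: cvg_cst | exact: h0].
  + exact: cvg_cst.
- apply: (@squeeze_cvgr _ _ _ _ (fun=> 0) (fun m => harmonic m)) => //;
    last exact: cvg_cst.
  near=> m; rewrite /step_approx arg.
  set t := (X in sigmoid X); have /andP[-> _] := sigmoid_bound t; rewrite /=.
  have tm : m%:R <= - t.
    have : 0 <= m%:R ^+ 2 * (a - y) by rewrite mulr_ge0// subr_ge0.
    by rewrite /t; lra.
  have t0 : 0 <= - t by rewrite (le_trans _ tm).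
  rewrite -(opprK t); apply: (le_trans (sigmoid_upper t0)).
  by rewrite /harmonic/= lef_pV2 ?posrE ?ltr_pwDl// -natr1 [leRHS]addrC lerD2r.
Unshelve. all: by end_near. Qed.

Lemma step_approx_bound (a : R) m y : 0 <= step_approx a m y <= 1.
Proof. exact: sigmoid_bound. Qed.

Lemma test_step_approx n (l : 'I_n) (a : R) m :
  exists h' : R -> R, test_function (fun x : 'cV[R]_n => step_approx a m (x l 0))
    (fun x => h' (x l 0) *: delta_mx l 0).
Proof.
pose b := - (m%:R ^+ 2 * a + m%:R); pose k : R := m%:R ^+ 2.
have k0 : 0 <= k by exact: sqr_ge0.
exists (fun y => sigmoid' (b + y * k) * k).
apply: (@test_coord _ _ l (step_approx a m) (fun y => sigmoid' (b + y * k) * k)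
  (1 + k)).
- move=> t; have /andP[h0 h1] := step_approx_bound a m t.
  by rewrite ger0_norm// (le_trans h1)// lerDl.
- move=> t; rewrite normrM (ger0_norm k0).
  rewrite (@le_trans _ _ k)// ?lerDr//.
  by rewrite ler_piMl// sigmoid'_bound.
- move=> t; apply: (@is_derive1_comp _ sigmoid (fun y => b + y * k)).
    exact: is_derive_sigmoid.
  exact: is_derive_affine.
- move=> t; apply: cvgM; last exact: cvg_cst.
  apply: (@continuous_comp _ _ _ (fun y : R => b + y * k) sigmoid');
    last exact: continuous_sigmoid'.
  by apply: cvgD; [exact: cvg_cst | apply: cvgM; [exact: cvg_id|exact: cvg_cst]].
Qed.

(** Smooth approximations of the indicators of intersections of half-spaces
    [{x | a < x_l}], [(l, a)] ranging over [L]. *)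
Definition smooth_box {n} (L : seq ('I_n * R)) (m : nat) (x : 'cV[R]_n) : R :=
  \prod_(la <- L) step_approx la.2 m (x la.1 0).

Lemma smooth_box_bound n (L : seq ('I_n * R)) m x : 0 <= smooth_box L m x <= 1.
Proof.
rewrite /smooth_box; elim: L => [|[l a] L /andP[h0 h1]]; rewrite ?big_nil ?ler01 ?lexx//.
rewrite big_cons /=; have /andP[s0 s1] := step_approx_bound a m (x l 0).
by rewrite mulr_ge0//= mulr_ile1.
Qed.

Lemma smooth_box_cvg n (L : seq ('I_n * R)) (x : 'cV[R]_n) :
  smooth_box L m x @[m --> \oo] -->
    ((all (fun la : 'I_n * R => (la.2 < x la.1 0)%R) L)%:R : R).
Proof.
rewrite /smooth_box; elim: L => [|[l a] L IH].
  by under eq_fun do rewrite big_nil; exact: cvg_cst.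
under eq_fun do rewrite big_cons.
rewrite /= (_ : (_ && _)%:R = (a < x l 0)%R%:R *
    (all (fun la : 'I_n * R => (la.2 < x la.1 0)%R) L)%:R); last first.
  by case: (a < _); rewrite ?mul1r ?mul0r.
by apply: cvgM; [exact: step_approx_cvg | exact: IH].
Qed.

Lemma test_smooth_box n (L : seq ('I_n * R)) m :
  exists D : 'cV[R]_n -> 'cV[R]_n, test_function (smooth_box L m) D.
Proof.
rewrite /smooth_box; elim: L => [|[l a] L [D tD]].
  exists (fun=> 0); under eq_fun do rewrite big_nil; exact: test_cst1.
have [h' th] := test_step_approx l a m.
by eexists; under eq_fun do rewrite big_cons/=; exact: (test_mul th tD).
Qed.

End Sigmoid.

(** * Uncorrelated Gaussian vectors *)

Section Absorb.
Context {d : measure_display} {T : measurableType d} {R : realType}.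
Variable P : probability T R.
Implicit Types (F G H : set_system T).

Lemma integral_indicE (A : set T) (Z : T -> R) : measurable A ->
  (\int[P]_w (\1_A w * Z w)%:E = \int[P]_(w in A) (Z w)%:E)%E.
Proof.
move=> mA; rewrite [RHS]integral_mkcond; apply: eq_integral => w _.
by rewrite epatch_indic EFinM muleC.
Qed.

Lemma dynkin_centered (Z : T -> R) : P.-integrable setT (EFin \o Z) ->
  (\int[P]_w (Z w)%:E = 0)%E ->
  dynkin [set A | measurable A /\ (\int[P]_w (\1_A w * Z w)%:E = 0)%E].
Proof.
move=> iZ Z0; split=> /=.
- by split=> //; under eq_integral do rewrite indicT mul1r.
- move=> A [mA A0]; split; first exact: measurableC.
  transitivity (\int[P]_w ((Z w)%:E - (\1_A w * Z w)%:E))%E.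
    apply: eq_integral => w _; rewrite -EFinB; congr (_%:E).
    by rewrite !indicE in_setC; case: (w \in A) => /=; ring.
  by rewrite integralB// ?Z0 ?A0 ?sube0//; exact: integrable_indicM.
- move=> A tA AZ; have mA n : measurable (A n) by case: (AZ n).
  have mU : measurable (\bigcup_n A n) by exact: bigcupT_measurable.
  split=> //; rewrite integral_indicE// integral_bigcup//; last first.
    exact: (integrableS measurableT).
  by apply: eseries0 => n _ _; rewrite -integral_indicE//; case: (AZ n).
Qed.

(** By the pi-lambda theorem, since integrals over disjoint events add up. *)
Lemma centered_sigma_algebra (C : set_system T) (Z : T -> R) :
  C `<=` measurable -> setI_closed C -> C setT ->
  P.-integrable setT (EFin \o Z) -> centered P C Z -> centered P <<s C >> Z.
Proof.
move=> mC CI CT iZ cZ A sA.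
have Z0 : (\int[P]_w (Z w)%:E = 0)%E.
  by rewrite -(cZ _ CT); apply: eq_integral => w _; rewrite indicT mul1r.
suff [] : measurable A /\ (\int[P]_w (\1_A w * Z w)%:E = 0)%E by [].
apply: (pi_lambda CI _ (dynkin_centered iZ Z0)) sA => B CB.
by split; [exact: mC | exact: cZ].
Qed.

(** Gaussian vectors that are uncorrelated are independent. With a vanishing
    cross-covariance, a factor of the test function that depends on the lower
    block only contributes no derivative to the identity for the upper block, so
    it acts as a weight. Smooth boxes in the lower block are such factors. Their
    limits are the indicators of intersections of half-spaces, which, together
    with the events of [F], form a pi-system that generates the enlarged
    sigma-algebra. *)
Lemma gaussian_given_absorb n q F (V : T -> 'cV[R]_(n + q)) (S : 'M[R]_(n + q)) :
  sigma_algebra setT F -> F `<=` measurable -> gaussian_given P F V S ->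
  ursubmx S = 0 ->
  gaussian_given P <<s F `|` sigma_vec (fun w => dsubmx (V w)) >>
    (fun w => usubmx (V w)) (ulsubmx S).
Proof.
move=> sF mF [mV iV sV] S0.
pose U : 'M[R]_(n, n + q) := row_mx 1%:M 0.
pose W : 'M[R]_(q, n + q) := row_mx 0 1%:M.
have UE (x : 'cV[R]_(n + q)) : U *m x = usubmx x.
  by rewrite -[x in LHS]vsubmxK mul_row_col mul1mx mul0mx addr0.
have WE (x : 'cV[R]_(n + q)) : W *m x = dsubmx x.
  by rewrite -[x in LHS]vsubmxK mul_row_col mul1mx mul0mx add0r.
have UTE (x : 'cV[R]_n) : U^T *m x = col_mx x 0.
  by rewrite tr_row_mx trmx1 trmx0 mul_col_mx mul1mx mul0mx.
have WTE (x : 'cV[R]_q) : W^T *m x = col_mx 0 x.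
  by rewrite tr_row_mx trmx1 trmx0 mul_col_mx mul1mx mul0mx.
have SE (a b : R) (g : 'cV[R]_n) (h : 'cV[R]_q) i :
    (S *m (a *: col_mx g 0 + b *: col_mx 0 h)) (lshift q i) 0
    = a * (ulsubmx S *m g) i 0.
  rewrite !scale_col_mx !scaler0 add_col_mx add0r addr0 -[S in LHS]submxK S0.
  by rewrite mul_block_col mul0mx addr0 col_mxEu -scalemxAr mxE.
have compU i : component (fun w => usubmx (V w)) i = component V (lshift q i).
  by apply/funext => w; rewrite /component mxE.
have mU : random_vector (fun w => usubmx (V w)) by move=> i; rewrite compU; exact: mV.
have iU i : P.-integrable setT (EFin \o component (fun w => usubmx (V w)) i).
  by rewrite compU; exact: iV.
split=> // f Df tf i.
pose Z w := stein_term (ulsubmx S) f Df i (usubmx (V w)) (usubmx (V w)).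
have iZ : P.-integrable setT (EFin \o Z) by exact: stein_term_integrable.
pose box (L : seq ('I_q * R)) : set T :=
  [set w | all (fun la : 'I_q * R => (la.2 < dsubmx (V w) la.1 0)%R) L].
pose C : set_system T := [set A | exists2 B, F B & exists L, A = B `&` box L].
have mbox L : measurable (box L).
  rewrite (_ : box L = \big[setI/setT]_(la <- L)
      ((component V (rshift n la.1)) @^-1` `]la.2, +oo[%classic)).
    apply: big_ind => //; first exact: measurableI.
    move=> [l a] _; rewrite -[X in measurable X]setTI.
    by apply: mV => //; exact: measurable_itv.
  rewrite /box; elim: L => [|[l a] L IH]; rewrite ?big_nil ?big_cons -?IH.
    by apply/seteqP; split.
  apply/seteqP; split=> w /=.
    by move=> /andP[h1 h2]; split=> //; move: h1; rewrite in_itv/= andbT mxE.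
  by move=> [h1 h2]; apply/andP; split=> //; move: h1; rewrite in_itv/= andbT mxE.
have step A : C A -> (\int[P]_w (\1_A w * Z w)%:E = 0)%E.
  move=> [B FB [L ->]].
  have mB : measurable B by exact: mF.
  (* The Stein identity with the test function [f] times a smooth box. *)
  have stepm m : (\int[P]_w (\1_B w * (smooth_box L m (dsubmx (V w)) * Z w))%:E = 0)%E.
    have [D tD] := test_smooth_box L m.
    have := sV _ _ (test_mul (test_pullback W tD) (test_pullback U tf)) (lshift q i) B FB.
    rewrite (_ : (\int[P]_w _)%E = (\int[P]_w (\1_B w *
        (smooth_box L m (dsubmx (V w)) * Z w))%:E)%E)//.
    apply: eq_integral => w _; congr (_ * _)%:E.
    have Xi : V w (lshift q i) 0 = usubmx (V w) i 0 by rewrite [RHS]mxE.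
    by rewrite /stein_term !WE !UE WTE UTE SE /Z /stein_term Xi; ring.
  have mbx m : measurable_fun setT (fun w => smooth_box L m (dsubmx (V w))).
    have [D tD] := test_smooth_box L m.
    apply: (test_measurable tD (X := fun w => dsubmx (V w))) => l.
    rewrite (_ : component _ l = component V (rshift n l)); first exact: mV.
    by apply/funext => w; rewrite /component mxE.
  have mZ : measurable_fun setT Z.
    by apply/measurable_EFinP; exact: (measurable_int P iZ).
  have mI A' : measurable A' -> measurable_fun setT (\1_A' : T -> R).
    by move=> mA'; exact: measurable_indic.
  have ind01 (A' : set T) w : 0 <= (\1_A' w : R) <= 1.
    by rewrite indicE; case: (_ \in _) => /=; rewrite ?ler01 ?lexx.
  case: (@dominated_convergence _ _ _ P setT measurableT
    (fun m w => (\1_B w * (smooth_box L m (dsubmx (V w)) * Z w))%:E)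
    (fun w => (\1_(B `&` box L) w * Z w)%:E) (fun w => `|(Z w)%:E|)%E).
  - move=> m; apply/measurable_EFinP; apply: measurable_funM; first exact: mI.
    exact: measurable_funM.
  - by apply/measurable_EFinP; apply: measurable_funM => //; apply: mI; exact: measurableI.
  - apply: aeW => w _; apply/cvg_EFin; first exact: nearW.
    have -> : \1_(B `&` box L) w * Z w = \1_B w * (\1_(box L) w * Z w).
      by rewrite indicI /= mulrA.
    apply: cvgM; first exact: cvg_cst.
    apply: cvgM; last exact: cvg_cst.
    rewrite (_ : \1_(box L) w =
        (all (fun la : 'I_q * R => (la.2 < dsubmx (V w) la.1 0)%R) L)%:R).
      exact: (@smooth_box_cvg R q L (dsubmx (V w))).
    by rewrite indicE; congr (_%:R); congr nat_of_bool; apply/idP/idP; rewrite inE.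
  - exact: integrable_abse.
  - apply: aeW => w m _; rewrite !abse_EFin lee_fin !normrM.
    have /andP[b0 b1] := smooth_box_bound L m (dsubmx (V w)).
    have /andP[i0 i1] := ind01 B w.
    rewrite (ger0_norm b0) (ger0_norm i0) mulrA ler_piMl//.
    by rewrite mulr_ile1.
  move=> _ _ lim; apply: (cvg_unique _ lim); first exact: ereal_hausdorff.
  rewrite (_ : [sequence _]_n = cst 0%E); first exact: cvg_cst.
  by apply/funext => m /=; exact: stepm.
have mC : C `<=` measurable.
  by move=> _ [B FB [L ->]]; apply: measurableI; [exact: mF | exact: mbox].
have CI : setI_closed C.
  move=> _ _ [B1 F1 [L1 ->]] [B2 F2 [L2 ->]].
  exists (B1 `&` B2).
    have := @measurableI _ (g_sigma_algebraType F) B1 B2.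
    by rewrite (measurable_g_measurableTypeE sF); apply.
  exists (L1 ++ L2); rewrite setIACA; congr (_ `&` _).
  apply/seteqP; split=> w; rewrite /box/= all_cat.
    by move=> [-> ->].
  by move=> /andP[].
have FT : F setT by exact: dynkinT (sigma_algebra_dynkin sF).
have CT : C setT.
  by exists setT => //; exists [::]; apply/seteqP; split.
have cC := centered_sigma_algebra mC CI CT iZ step.
move=> A sA; apply: cC; move: sA; apply: smallest_sub.
  exact: smallest_sigma_algebra.
move=> B [FB|]; first by apply: sub_sigma_algebra; exists B => //; exists [::];
  apply/seteqP; split=> w //= [].
apply: (@sigma_of_sub d T R _ <<s C>>); first exact: smallest_sigma_algebra.
move=> _ [l _ <-]; apply/measurable_wrtP; first exact: smallest_sigma_algebra.
move=> mT; apply: (measurability _ (RGenOInfty.measurableE R)) => //.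
move=> _ [_ [a ->] <-]; rewrite setTI.
apply: sub_sigma_algebra; apply: sub_sigma_algebra.
exists setT => //; exists [:: (l, a)]; rewrite setTI.
by apply/seteqP; split=> w; rewrite /box /= in_itv/= !andbT.
Qed.

End Absorb.

(** * Orthogonality and the mean square error *)

Section Orthogonality.
Import HBNNSimple.
Context {d : measure_display} {T : measurableType d} {R : realType}.
Variable P : probability T R.
Implicit Types (F : set_system T).

(** [g] is an increasing limit of [F]-measurable simple functions, against which
    [e] integrates to 0 by hypothesis. *)
Lemma centered_mul_ge0 F (e g : T -> R) :
  sigma_algebra setT F -> F `<=` measurable ->
  P.-integrable setT (EFin \o e) -> centered P F e ->
  measurable_wrt F g -> (forall w, 0 <= g w) ->
  P.-integrable setT (EFin \o (fun w => g w * e w)) ->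
  (\int[P]_w (g w * e w)%:E = 0)%E.
Proof.
move=> sF mF ie ce gF g0 ige.
have rg := (measurable_wrtP _ sF).1 gF.
have rEg : measurable_fun (setT : set (g_sigma_algebraType F)) (EFin \o g).
  exact/measurable_EFinP.
have [h [ndh hg]] := approximation measurableT rEg (fun w _ => g0 w).
pose u n : T -> R := h n.
have ug w : u n w @[n --> \oo] --> g w.
  exact: (fine_cvg (hg w I)).
have ule n w : u n w <= g w.
  rewrite -(cvg_lim (@Rhausdorff R) (@ug w)).
  apply: (@nondecreasing_cvgn_le _ (u ^~ w)); last by apply/cvg_ex; exists (g w).
  by move=> a b ab; have /lefP := ndh a b ab; apply.
have u0 n w : 0 <= u n w by exact: fun_ge0.
have mu_ n : measurable_fun setT (u n).
  apply: (measurable_wrt_ambient mF); apply/(measurable_wrtP _ sF).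
  exact: measurable_funP.
have me : measurable_fun setT e by apply/measurable_EFinP; exact: (measurable_int P ie).
have un n : (\int[P]_w (u n w * e w)%:E = 0)%E.
  have uE w : u n w = _ := fimfunEord (h n) w.
  under eq_integral do rewrite uE mulr_suml -sumEFin.
  rewrite integral_sum//=.
    rewrite big1// => i _.
    set B := (h n @^-1` _).
    have FB : F B.
      rewrite -(measurable_g_measurableTypeE sF) -[B]setTI.
      by apply: measurable_funP => //; exact: measurable_set1.
    under eq_integral do rewrite -mulrA EFinM.
    rewrite integralZl// ?(ce _ FB) ?mule0//.
    by apply: integrable_indicM => //; exact: mF.
  move=> i; set B := (h n @^-1` _).
  have FB : F B.
    rewrite -(measurable_g_measurableTypeE sF) -[B]setTI.
    by apply: measurable_funP => //; exact: measurable_set1.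
  under eq_fun do rewrite -mulrA EFinM.
  by apply: integrableZl => //; apply: integrable_indicM => //; exact: mF.
case: (@dominated_convergence _ _ _ P setT measurableT
    (fun m w => (u m w * e w)%:E) (fun w => (g w * e w)%:E)
    (fun w => `|(g w * e w)%:E|)%E).
- by move=> m; apply/measurable_EFinP; exact: measurable_funM.
- exact: (measurable_int P ige).
- apply: aeW => w _; apply/cvg_EFin; first exact: nearW.
  by apply: cvgM; [exact: ug | exact: cvg_cst].
- exact: integrable_abse.
- apply: aeW => w m _; rewrite !abse_EFin lee_fin !normrM ler_wpM2r//.
  by rewrite !ger0_norm.
move=> _ _ lim; apply: (cvg_unique _ lim); first exact: ereal_hausdorff.
rewrite (_ : [sequence _]_n = cst 0%E); first exact: cvg_cst.
by apply/funext => m /=; exact: un.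
Qed.

Lemma centered_mul F (e g : T -> R) :
  sigma_algebra setT F -> F `<=` measurable ->
  P.-integrable setT (EFin \o e) -> centered P F e -> measurable_wrt F g ->
  P.-integrable setT (EFin \o (fun w => g w * e w)) ->
  (\int[P]_w (g w * e w)%:E = 0)%E.
Proof.
move=> sF mF ie ce gF ige.
have rg := (measurable_wrtP _ sF).1 gF.
have me : measurable_fun setT e by apply/measurable_EFinP; exact: (measurable_int P ie).
have part (h : T -> R) : measurable_wrt F h -> (forall w, 0 <= h w) ->
    (forall w, h w <= `|g w|) ->
    P.-integrable setT (EFin \o (fun w => h w * e w)) /\
    (\int[P]_w (h w * e w)%:E = 0)%E.
  move=> hF h0 hg.
  have ih : P.-integrable setT (EFin \o (fun w => h w * e w)).
    apply: le_integrable ige => //.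
      apply/measurable_EFinP; apply: measurable_funM => //.
      exact: measurable_wrt_ambient hF.
    by move=> w _ /=; rewrite lee_fin !normrM ler_wpM2r// ger0_norm.
  by split=> //; exact: (centered_mul_ge0 sF mF).
have [ip p0] : P.-integrable setT (EFin \o (fun w => g^\+ w * e w)) /\
    (\int[P]_w (g^\+ w * e w)%:E = 0)%E.
  apply: part.
  - by apply/(measurable_wrtP _ sF); exact: measurable_funrpos.
  - exact: funrpos_ge0.
  - by move=> w; rewrite /funrpos ge_max ler_norm normr_ge0.
have [im m0] : P.-integrable setT (EFin \o (fun w => g^\- w * e w)) /\
    (\int[P]_w (g^\- w * e w)%:E = 0)%E.
  apply: part.
  - by apply/(measurable_wrtP _ sF); exact: measurable_funrneg.
  - exact: funrneg_ge0.
  - by move=> w; rewrite /funrneg ge_max normr_ge0 -normrN ler_norm.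
transitivity (\int[P]_w ((g^\+ w * e w)%:E - (g^\- w * e w)%:E))%E.
  apply: eq_integral => w _; rewrite -EFinB -mulrBl; congr (_ * _)%:E.
  by rewrite -[in LHS](funrposBneg g).
by rewrite integralB//= p0 m0 sube0.
Qed.

(** The cross term of the square vanishes. It is integrable because [g], as the
    difference of [e + g] and [e], is square integrable as soon as the right-hand
    side is finite. *)
Lemma centered_optimal F (e g : T -> R) :
  sigma_algebra setT F -> F `<=` measurable ->
  P.-integrable setT (EFin \o e) ->
  P.-integrable setT (EFin \o (fun w => e w ^+ 2)) ->
  centered P F e -> measurable_wrt F g ->
  (\int[P]_w (e w ^+ 2)%:E <= \int[P]_w ((e w + g w) ^+ 2)%:E)%E.
Proof.
move=> sF mF ie ie2 ce gF.
have mg := measurable_wrt_ambient mF gF.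
have me : measurable_fun setT e by apply/measurable_EFinP; exact: (measurable_int P ie).
have mf : measurable_fun setT (EFin \o (fun w => (e w + g w) ^+ 2)).
  by apply/measurable_EFinP; apply: measurable_funX; exact: measurable_funD.
have [foo|] := ltP (\int[P]_w ((e w + g w) ^+ 2)%:E)%E +oo%E; last first.
  by move=> h; apply: (le_trans _ h); exact: leey.
have if2 : P.-integrable setT (EFin \o (fun w => (e w + g w) ^+ 2)).
  apply/integrableP; split=> //.
  by under eq_integral do rewrite /= ger0_norm ?sqr_ge0//.
have ige : P.-integrable setT (EFin \o (fun w => g w * e w)).
  have idom : P.-integrable setT (fun w => (2%:E * (e w ^+ 2)%:E + ((e w + g w) ^+ 2)%:E)%E).
    by apply: integrableD => //; exact: integrableZl.
  apply: le_integrable idom => //.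
    by apply/measurable_EFinP; exact: measurable_funM.
  move=> w _; rewrite -EFinM -EFinD !abse_EFin lee_fin.
  have e2 := sqr_ge0 (e w); have s2 := sqr_ge0 (e w + g w).
  rewrite [leRHS]ger0_norm; last by rewrite addr_ge0// mulr_ge0.
  by rewrite ler_norml; apply/andP; split; nra.
have c0 := centered_mul sF mF ie ce gF ige.
rewrite -[leLHS]adde0 -[X in (_ + X <= _)%E](mule0 2%:E) -c0.
rewrite -integralZl// -integralD//=; last exact: integrableZl.
apply: le_integral => //=.
- by apply: integrableD => //; exact: integrableZl.
- move=> w _; rewrite -EFinM -EFinD lee_fin; have := sqr_ge0 (g w); nra.
Qed.

End Orthogonality.

Section MeanSquare.
Context {d : measure_display} {T : measurableType d} {R : realType}.
Variable P : probability T R.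

Lemma second_moment_diag n (e : T -> 'cV[R]_n) i :
  (second_moment P e i i = \int[P]_omega (component e i omega ^+ 2)%:E)%E.
Proof.
rewrite mxE unlock; apply: eq_integral => omega _.
by rewrite !mxE big_ord1 !mxE -expr2.
Qed.

(** The comparison is made in each coordinate, in the extended reals, where
    the moments of [f] may be infinite. *)
Lemma second_moment_trace_le n (Sigma : 'M[R]_n) (e f : T -> 'cV[R]_n) :
  second_moment P e = map_mx EFin Sigma ->
  (forall i, (\int[P]_omega (component e i omega ^+ 2)%:E
              <= \int[P]_omega (component f i omega ^+ 2)%:E)%E) ->
  ((\tr Sigma)%:E <= \tr (second_moment P f))%E.
Proof.
move=> eS ef; rewrite /mxtrace -sumEFin; apply: lee_sum => i _.
rewrite second_moment_diag; apply: le_trans (ef i).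
by rewrite -second_moment_diag eS mxE.
Qed.

End MeanSquare.

(** * The algebra of the Kalman gain *)

Section GainAlgebra.
Context {R : realType}.

(** The diagonal of a sum of Gram matrices consists of sums of squares. *)
Lemma gram_eq0 m n q (X : 'M[R]_(m, n)) (Y : 'M[R]_(q, n)) :
  X^T *m X + Y^T *m Y = 0 -> X = 0.
Proof.
move=> h; apply/matrixP => i j; rewrite mxE.
have := congr1 (fun M : 'M[R]_n => M j j) h; rewrite !mxE => /eqP.
rewrite paddr_eq0.
- case/andP => /eqP h1 _; apply/eqP; rewrite -sqrf_eq0 expr2.
  have := (psumr_eq0P (F := fun k => X^T j k * X k j) (P := xpredT)) _ h1 i isT.
  rewrite mxE => -> // k _; rewrite mxE -expr2; exact: sqr_ge0.
- by apply: sumr_ge0 => k _; rewrite mxE -expr2 sqr_ge0.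
- by apply: sumr_ge0 => k _; rewrite mxE -expr2 sqr_ge0.
Qed.

Lemma congruence_block (a b c : nat) (X : 'M[R]_(a, c)) (Y : 'M[R]_(b, c))
    (N : 'M[R]_c) :
  col_mx X Y *m N *m (col_mx X Y)^T
  = block_mx (X *m N *m X^T) (X *m N *m Y^T) (Y *m N *m X^T) (Y *m N *m Y^T).
Proof. by rewrite mul_col_mx tr_col_mx mul_col_row. Qed.

Variables (n p : nat) (A : 'M[R]_n) (C : 'M[R]_(p, n)).
Variables (sigma_w sigma_v : R) (s : {set 'I_p}).
Local Notation Cs := (rows s C).
Local Notation gain := (kalman_gain A C sigma_v s).

(** The normal equation of the gain. It holds for a singular innovation
    covariance too: a vector killed by the latter is killed by [S *m Cs^T],
    because [S] is a Gram matrix, and so the rows of [A *m S *m Cs^T] lie in the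
    row space on which [pinvmx] inverts. *)
Lemma kalman_gainP r (M : 'M[R]_(n, r)) (S := M *m M^T) :
  gain S *m (Cs *m S *m Cs^T + (sigma_v ^+ 2)%:M) = A *m S *m Cs^T.
Proof.
rewrite /kalman_gain mulmxKpV// submxE.
set Q := _ + _; set Y := cokermx Q.
have QY : Q *m Y = 0 by exact: mulmx_coker.
(* [Y] spans the kernel of [Q]; it is tested against the quadratic form [Q]. *)
suff SY : M^T *m (Cs^T *m Y) = 0 by rewrite /S -!mulmxA SY !mulmx0.
apply: (@gram_eq0 _ _ _ _ (sigma_v *: Y)).
transitivity (Y^T *m (Q *m Y)); last by rewrite QY mulmx0.
rewrite /Q /S mulmxDl mulmxDr; congr (_ + _).
  by rewrite !trmx_mul !trmxK !mulmxA.
have -> : (sigma_v *: Y)^T = sigma_v *: Y^T by rewrite linearZ.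
by rewrite mul_scalar_mx -!scalemxAr -scalemxAl scalerA expr2.
Qed.

Let Es : 'M[R]_(#|s|, p) := rows s 1%:M.

Lemma rowsE q (M : 'M[R]_(p, q)) : rows s M = Es *m M.
Proof. by rewrite /Es /rows mul_rowsub_mx mul1mx. Qed.

Lemma rows1_orthonormal : Es *m Es^T = 1%:M.
Proof.
apply/matrixP => i j; rewrite -rowsE !mxE.
by rewrite (inj_eq enum_val_inj) eq_sym.
Qed.

(** The pair (next error, innovation) is the image of (error, process noise,
    sensor noise) under three matrices, and [Sigma] is its covariance. The upper
    right block is the defect of the normal equation; where it vanishes, the upper
    left block is the Riccati recursion. *)
Lemma innovation_uncorrelated (S : 'M[R]_n) (K : 'M[R]_(n, #|s|)) :
  K *m (Cs *m S *m Cs^T + (sigma_v ^+ 2)%:M) = A *m S *m Cs^T ->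
  let Sigma := col_mx (A - K *m Cs) Cs *m S *m (col_mx (A - K *m Cs) Cs)^T
    + col_mx 1%:M 0 *m (sigma_w ^+ 2)%:M *m (col_mx 1%:M 0)^T
    + col_mx (- (K *m Es)) Es *m (sigma_v ^+ 2)%:M *m (col_mx (- (K *m Es)) Es)^T in
  ursubmx Sigma = 0 /\
  ulsubmx Sigma = A *m S *m A^T + (sigma_w ^+ 2)%:M - K *m Cs *m S *m A^T.
Proof.
move=> KP Sigma.
rewrite /Sigma !congruence_block !add_block_mx block_mxKur block_mxKul.
rewrite !trmx1 !trmx0 !mulmx0 !mulmx1 mul1mx addr0.
have EsE : Es *m (sigma_v ^+ 2)%:M *m Es^T = (sigma_v ^+ 2)%:M.
  by rewrite mul_mx_scalar -scalemxAl rows1_orthonormal scalemx1.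
have KE : K *m Es *m (sigma_v ^+ 2)%:M *m Es^T = K *m (sigma_v ^+ 2)%:M.
  by rewrite -[in RHS]EsE !mulmxA.
have KC : K *m Cs *m S *m Cs^T = A *m S *m Cs^T - K *m (sigma_v ^+ 2)%:M.
  by rewrite -KP mulmxDr addrK !mulmxA.
split.
- by rewrite !mulNmx KE !mulmxBl KC opprB addrCA subrr addr0 subrr.
- have -> : - (K *m Es) *m (sigma_v ^+ 2)%:M *m (- (K *m Es))^T
      = K *m (sigma_v ^+ 2)%:M *m K^T.
    by rewrite linearN/= mulmxN !mulNmx opprK trmx_mul mulmxA KE.
  rewrite linearB/= trmx_mul mulmxBr mulmxA !mulmxBl KC !mulmxBl opprB.
  rewrite (addrC (A *m S *m Cs^T *m K^T)).
  by rewrite addrK addrAC subrK addrAC.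
Qed.

(** The Riccati recursion is the covariance of a linear image, hence it
    preserves Gram matrices. *)
Lemma kalman_cov_gram (S0 : 'M[R]_n) r0 (M0 : 'M[R]_(n, r0)) t :
  S0 = M0 *m M0^T ->
  exists r (M : 'M[R]_(n, r)),
    kalman_cov A C sigma_w sigma_v s S0 t = M *m M^T.
Proof.
move=> S0E; elim: t => [|t [r [M SE]]] /=; first by exists r0, M0.
have KP : gain (M *m M^T) *m (Cs *m (M *m M^T) *m Cs^T + (sigma_v ^+ 2)%:M)
    = A *m (M *m M^T) *m Cs^T by exact: kalman_gainP.
rewrite SE; have [_ <-] := innovation_uncorrelated KP; set K := gain _.
exists (r + (n + p))%N, (row_mx ((A - K *m Cs) *m M)
  (row_mx sigma_w%:M (sigma_v *: (K *m Es)))).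
rewrite !congruence_block !add_block_mx block_mxKul !tr_row_mx !mul_row_col.
rewrite addrA trmx1 mulmx1 mul1mx tr_scalar_mx -scalar_mxM -expr2.
congr (_ + _ + _); first by rewrite trmx_mul !mulmxA.
rewrite linearN/= mulmxN !mulNmx opprK mul_mx_scalar -scalemxAl.
by rewrite linearZ/= -scalemxAr -scalemxAl scalerA expr2.
Qed.

End GainAlgebra.

(** * The history of the system *)

Section SystemInformation.
Context {d : measure_display} {T : measurableType d} {R : realType}.
Variable P : probability T R.
Variables (n m p : nat).
Variables (A : 'M[R]_n) (B : 'M[R]_(n, m)) (C : 'M[R]_(p, n)).
Variables (sigma_w sigma_v : R).
Variable u : nat -> 'cV[R]_m.
Variable x : nat -> T -> 'cV[R]_n.
Variables (w : nat -> T -> 'cV[R]_n) (v : nat -> T -> 'cV[R]_p).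
Variable z : int -> T -> 'cV[R]_p.
Hypothesis hsys : attack_free_system P A B C sigma_w sigma_v u x w v z.

Local Notation src := (randomness x w v z).

(** The process noise and the sensor noise are cut at different times, since
    the noises of one time step enter the filter one after the other. *)
Definition elapsed (a b : int) : set (option (nat + nat)) :=
  [set i | match i with
           | None => True
           | Some (inl t) => t%:Z < a
           | Some (inr t) => t%:Z < b
           end].

Definition history (a b : int) : set_system T := family_algebra src (elapsed a b).

Lemma src_algebra i : sigma_algebra setT (src i).
Proof. by case: i => [[t|t]|]; exact: sigma_of_algebra. Qed.

Lemma history_algebra a b : sigma_algebra setT (history a b).
Proof. exact: family_algebraP. Qed.

Lemma src_measurable i : src i `<=` measurable.
Proof.
case: i => [[t|t]|]; apply: sigma_of_sub; try exact: sigma_algebra_measurable.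
- move=> _ [i _ <-]; apply: measurable_wrt_measurable.
  exact: (process_noise hsys t).1.
- move=> _ [i _ <-]; apply: measurable_wrt_measurable.
  exact: (sensor_noise hsys t).1.
- move=> _ [[i _ <-]|[q _ <-]]; apply: measurable_wrt_measurable.
    exact: (state_rv hsys).
  exact: (output_rv hsys).
Qed.

Lemma history_measurable a b : history a b `<=` measurable.
Proof. exact/family_algebra_measurable/src_measurable. Qed.

Lemma vec_wrt_src (J : set (option (nat + nat))) q (X : T -> 'cV[R]_q) i :
  J i -> vec_measurable_wrt (src i) X -> vec_measurable_wrt (family_algebra src J) X.
Proof.
move=> Ji hX l; apply: (subset_trans (hX l)); exact: family_algebra_sub.
Qed.

Lemma process_noise_wrt (J : set (option (nat + nat))) t :
  J (Some (inl t)) -> vec_measurable_wrt (family_algebra src J) (w t).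
Proof.
move=> Jt; apply: (vec_wrt_src Jt) => l.
by apply: sigma_of_measurable; exists l.
Qed.

Lemma sensor_noise_wrt (J : set (option (nat + nat))) t :
  J (Some (inr t)) -> vec_measurable_wrt (family_algebra src J) (v t).
Proof.
move=> Jt; apply: (vec_wrt_src Jt) => l.
by apply: sigma_of_measurable; exists l.
Qed.

(** The state at time [t] depends on the process noise strictly before [t],
    whence [t <= a], and on no sensor noise. *)
Lemma state_wrt a b (t : nat) : t%:Z <= a -> vec_measurable_wrt (history a b) (x t).
Proof.
have sH := history_algebra a b.
elim: t => [_|t IH ta].
  apply: (@vec_wrt_src _ _ _ None) => // l.
  by apply: sigma_of_measurable; left; exists l.
have ta' : t%:Z < a by rewrite (lt_le_trans _ ta)// ltz_nat.
apply/(vec_measurable_wrtP _ sH).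
rewrite (_ : x t.+1 = fun omega => A *m x t omega + B *m u t + w t omega); last first.
  by apply/funext => omega; exact: (state_eq hsys).
apply: random_vectorD; last first.
  by apply/(vec_measurable_wrtP _ sH); exact: process_noise_wrt.
apply: random_vectorD; last exact: random_vector_cst.
apply: random_vector_mulmx; apply/(vec_measurable_wrtP _ sH); apply: IH.
exact: ltW.
Qed.

Lemma output_wrt a b (tau : int) : tau <= a -> tau < b ->
  vec_measurable_wrt (history a b) (z tau).
Proof.
have sH := history_algebra a b.
case: tau => t ta tb.
- apply/(vec_measurable_wrtP _ sH).
  rewrite (_ : z (Posz t) = fun omega => C *m x t omega + v t omega); last first.
    by apply/funext => omega; exact: (output_eq hsys).
  apply: random_vectorD.
    by apply: random_vector_mulmx; apply/(vec_measurable_wrtP _ sH); exact: state_wrt.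
  by apply/(vec_measurable_wrtP _ sH); exact: sensor_noise_wrt.
- apply: (@vec_wrt_src _ _ _ None) => // l.
  by apply: sigma_of_measurable; right; exists (Negz t, l).
Qed.

Lemma readings_wrt a b (S : set (int * 'I_p)) :
  (forall q, S q -> q.1 <= a /\ q.1 < b) -> sigma_readings z S `<=` history a b.
Proof.
move=> hS; apply: sigma_of_sub; first exact: history_algebra.
by move=> _ [q Sq <-]; have [qa qb] := hS q Sq; exact: (output_wrt qa qb).
Qed.

Lemma history_indep a b (J : set (option (nat + nat))) :
  (forall i, J i -> ~ elapsed a b i) ->
  independent2 P (history a b) (family_algebra src J).
Proof.
move=> hJ; apply: mutually_independent_split.
- exact: src_algebra.
- exact: src_measurable.
- exact: (noise_indep hsys).
- by apply/seteqP; split=> // i [hi /hJ].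
Qed.

End SystemInformation.

(** * The filtering error *)

Section KalmanFiltering.
Context {d : measure_display} {T : measurableType d} {R : realType}.
Variable P : probability T R.
Variables (n m p : nat).
Variables (A : 'M[R]_n) (B : 'M[R]_(n, m)) (C : 'M[R]_(p, n)).
Variables (sigma_w sigma_v : R).
Variable u : nat -> 'cV[R]_m.
Variable x : nat -> T -> 'cV[R]_n.
Variables (w : nat -> T -> 'cV[R]_n) (v : nat -> T -> 'cV[R]_p).
Variable z : int -> T -> 'cV[R]_p.
Hypothesis hsys : attack_free_system P A B C sigma_w sigma_v u x w v z.
Variables (s : {set 'I_p}) (Pst : 'M[R]_n) (xhat0 : T -> 'cV[R]_n).
Hypothesis hst : steady_state_kalman P A B C sigma_w sigma_v u x z s Pst xhat0.

Local Notation xhat := (kalman_estimate A B C sigma_w sigma_v u z s Pst xhat0).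
Local Notation cov := (kalman_cov A C sigma_w sigma_v s Pst).
Local Notation past t := (sigma_readings z [set q | q.1 < t%:Z /\ q.2 \in s]).
Local Notation hist a b := (history x w v z a b).

Lemma past_algebra (t : nat) : sigma_algebra setT (past t).
Proof. exact: sigma_of_algebra. Qed.

Lemma past_history (t : nat) : past t `<=` hist t%:Z t%:Z.
Proof. by apply: (readings_wrt hsys) => q [qt _]; split=> //; exact: ltW. Qed.

Lemma past_mono (t : nat) : past t `<=` past t.+1.
Proof.
apply: sigma_of_sub; first exact: past_algebra.
move=> _ [q [qt qs] <-]; apply: sigma_of_measurable; exists q => //.
by split=> //; rewrite (lt_trans qt)// ltz_nat.
Qed.

Lemma rows_reading_wrt (t : nat) :
  vec_measurable_wrt (past t.+1) (fun omega => rows s (z t%:Z omega)).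
Proof.
move=> j; rewrite (_ : component _ j = component (z t%:Z) (enum_val j)).
  apply: sigma_of_measurable; exists (t%:Z, enum_val j) => //=.
  by split; [rewrite ltz_nat | exact: enum_valP].
by apply/funext => omega; rewrite /component mxE.
Qed.

Lemma kalman_estimate_wrt (t : nat) : vec_measurable_wrt (past t) (xhat t).
Proof.
elim: t => [|t IH]; first exact: (init_measurable hst).
have sF := past_algebra t.+1.
have rx : random_vector (xhat t : g_sigma_algebraType (past t.+1) -> 'cV[R]_n).
  apply/(vec_measurable_wrtP _ sF) => i; apply: (subset_trans (IH i)).
  exact: past_mono.
apply/(vec_measurable_wrtP _ sF) => /=.
apply: random_vectorD.
  apply: random_vectorD; last exact: random_vector_cst.
  exact: random_vector_mulmx.
apply: random_vector_mulmx; apply: random_vectorB.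
  by apply/(vec_measurable_wrtP _ sF); exact: rows_reading_wrt.
exact: random_vector_mulmx.
Qed.

Lemma filter_error_wrt (t : nat) :
  vec_measurable_wrt (hist t%:Z t%:Z) (error (x t) (xhat t)).
Proof.
have sH := history_algebra x w v z t%:Z t%:Z.
apply/(vec_measurable_wrtP _ sH); apply: random_vectorB.
  by apply/(vec_measurable_wrtP _ sH); exact: (state_wrt hsys).
apply/(vec_measurable_wrtP _ sH) => i.
by apply: (subset_trans (@kalman_estimate_wrt t i)); exact: past_history.
Qed.

Let K t := kalman_gain A C sigma_v s (cov t).
Let Es : 'M[R]_(#|s|, p) := rows s 1%:M.
Let innovation (t : nat) omega :=
  rows s (z t%:Z omega) - rows s C *m xhat t omega.

Lemma error_innovation_recursion (t : nat) omega :
  col_mx (error (x t.+1) (xhat t.+1) omega) (innovation t omega)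
  = col_mx (A - K t *m rows s C) (rows s C) *m error (x t) (xhat t) omega
    + col_mx 1%:M 0 *m w t omega + col_mx (- (K t *m Es)) Es *m v t omega.
Proof.
have nuE : innovation t omega
    = rows s C *m error (x t) (xhat t) omega + Es *m v t omega.
  rewrite /innovation (output_eq hsys) rowsE mulmxDr mulmxA -rowsE addrAC.
  by rewrite -mulmxBr.
rewrite !mul_col_mx !add_col_mx mul0mx addr0 mul1mx; congr col_mx => //.
rewrite /error (state_eq hsys) /= -/(innovation t omega) -/(K t) nuE.
rewrite mulmxDr !mulmxA mulNmx mulmxBl /error.
rewrite [A *m (_ - _)]mulmxBr.
move: (A *m x t omega) (A *m xhat t omega) (B *m u t) (w t omega)
  (K t *m rows s C *m _) (K t *m Es *m v t omega) => a b g h q r.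
by apply/colP => i; rewrite !mxE; ring.
Qed.

(** The filtering error is Gaussian, with the covariance of the Riccati
    recursion, and independent of the past readings. The two noises of the step
    are added one at a time, each independent of the history that precedes it;
    then the innovation is absorbed into the past. *)
Lemma kalman_filter_gaussian (t : nat) :
  gaussian_given P (past t) (error (x t) (xhat t)) (cov t).
Proof.
have mpast t' : past t' `<=` measurable.
  apply: (subset_trans (@past_history t')); exact: (history_measurable hsys).
have mT : [set setT] `<=` @measurable _ T by move=> _ ->.
have [r0 [M0 S0E]] := gaussian_vector_gram (init_gaussian hst).
elim: t => [|t IH].
  have g0 := gaussian_vector_given (init_gaussian hst).
  split; [exact: (gg_measurable g0) | exact: (gg_integrable g0) |].
  move=> f Df tf i D FD /=.
  have [c [c0 cP]] := stein_term_bound Pst i tf.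
  have se : sigma_algebra setT (sigma_vec (error (x 0%N) xhat0)) by exact: sigma_of_algebra.
  have sp : sigma_algebra setT (past 0%N) by exact: past_algebra.
  have me : sigma_vec (error (x 0%N) xhat0) `<=` measurable.
    apply: sigma_of_sub; first exact: sigma_algebra_measurable.
    move=> _ [l _ <-]; apply: measurable_wrt_measurable.
    exact: (gg_measurable g0).
  have e0 : vec_measurable_wrt (sigma_vec (error (x 0%N) xhat0)) (error (x 0%N) xhat0).
    by move=> l; apply: sigma_of_measurable; exists l.
  have zero (q : nat) : vec_measurable_wrt (past 0%N) (fun _ : T => 0 : 'cV[R]_q).
    by apply/(vec_measurable_wrtP _ sp); exact: random_vector_cst.
  have HT : sigma_vec (error (x 0%N) xhat0) setT.
    exact: dynkinT (sigma_algebra_dynkin se).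
  (* A convolution with the vector 0: only the event [D] of the past is used. *)
  have := stein_convolution se sp me (mpast 0%N) (init_indep hst) e0 (zero n)
    HT FD (gg_integrable g0 i) tf
    (fun y => gg_stein g0 (test_translate y tf) i erefl).
  by under eq_integral do rewrite indicT mul1r addr0.
have [r [M SE]] := kalman_cov_gram A C sigma_w sigma_v s t S0E.
have KP : K t *m (rows s C *m cov t *m (rows s C)^T + (sigma_v ^+ 2)%:M)
    = A *m cov t *m (rows s C)^T.
  by rewrite /K SE; exact: kalman_gainP.
have [cross next] := innovation_uncorrelated sigma_w KP.
set N1 := col_mx (A - K t *m rows s C) (rows s C).
set N2 : 'M[R]_(n + #|s|, n) := col_mx 1%:M 0.
set N3 := col_mx (- (K t *m Es)) Es.
have gX1 := gaussian_given_mulmx N1 (mpast t) IH.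
have gw := gaussian_given_mulmx N2 mT (gaussian_vector_given (process_noise hsys t)).
have gv := gaussian_given_mulmx N3 mT (gaussian_vector_given (sensor_noise hsys t)).
have sH a b := history_algebra x w v z a b.
have mH a b : hist a b `<=` measurable by exact: (history_measurable hsys).
have sF := family_algebraP (randomness x w v z).
have mF (J : set (option (nat + nat))) :
    family_algebra (randomness x w v z) J `<=` measurable.
  exact/family_algebra_measurable/(src_measurable hsys).
have tt : t%:Z <= t%:Z + 1 by rewrite lerDl.
have X1h : vec_measurable_wrt (hist t%:Z t%:Z) (fun omega => N1 *m error (x t) (xhat t) omega).
  apply/(vec_measurable_wrtP _ (sH _ _)); apply: random_vector_mulmx.
  by apply/(vec_measurable_wrtP _ (sH _ _)); exact: filter_error_wrt.
have X1F : past t `<=` hist t%:Z t%:Z by exact: past_history.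
have X2w : vec_measurable_wrt (family_algebra (randomness x w v z) [set Some (inl t)])
    (fun omega => N2 *m w t omega).
  apply/(vec_measurable_wrtP _ (sF _)); apply: random_vector_mulmx.
  by apply/(vec_measurable_wrtP _ (sF _)); exact: process_noise_wrt.
have X3v : vec_measurable_wrt (family_algebra (randomness x w v z) [set Some (inr t)])
    (fun omega => N3 *m v t omega).
  apply/(vec_measurable_wrtP _ (sF _)); apply: random_vector_mulmx.
  by apply/(vec_measurable_wrtP _ (sF _)); exact: sensor_noise_wrt.
have ind1 : independent2 P (hist t%:Z t%:Z)
    (family_algebra (randomness x w v z) [set Some (inl t)]).
  by apply: (history_indep hsys) => _ -> /=; rewrite ltxx.
have ind2 : independent2 P (hist (t%:Z + 1) t%:Z)
    (family_algebra (randomness x w v z) [set Some (inr t)]).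
  by apply: (history_indep hsys) => _ -> /=; rewrite ltxx.
have hh : hist t%:Z t%:Z `<=` hist (t%:Z + 1) t%:Z.
  by apply: family_algebra_mono => -[[]|] //= t'; lia.
have g12 := gaussian_given_add (sH _ _) (sF _) (mH _ _) (mF _) ind1 X1F X1h X2w gX1 gw.
have X12h : vec_measurable_wrt (hist (t%:Z + 1) t%:Z)
    (fun omega => N1 *m error (x t) (xhat t) omega + N2 *m w t omega).
  apply/(vec_measurable_wrtP _ (sH _ _)); apply: random_vectorD;
    apply/(vec_measurable_wrtP _ (sH _ _)) => l.
    by apply: (subset_trans (X1h l)).
  apply: (subset_trans (X2w l)); apply: family_algebra_mono => _ -> /=; lia.
have g123 := gaussian_given_add (sH _ _) (sF _) (mH _ _) (mF _) ind2
  (subset_trans X1F hh) X12h X3v g12 gv.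
have := gaussian_given_absorb (past_algebra t) (mpast t) g123 cross.
rewrite next => gfin.
have VE omega := error_innovation_recursion t omega.
have eE : (fun omega => usubmx (N1 *m error (x t) (xhat t) omega
    + N2 *m w t omega + N3 *m v t omega)) = error (x t.+1) (xhat t.+1).
  by apply/funext => omega; rewrite -VE col_mxKu.
have nE : (fun omega => dsubmx (N1 *m error (x t) (xhat t) omega
    + N2 *m w t omega + N3 *m v t omega)) = innovation t.
  by apply/funext => omega; rewrite -VE col_mxKd.
rewrite eE nE in gfin.
apply: gaussian_given_sub gfin.
set G := <<s _ >>; have sG : sigma_algebra setT G by exact: smallest_sigma_algebra.
apply: sigma_of_sub => // _ [[tau i] [/= taut si] <-].
have FG : past t `<=` G by move=> E FE; apply: sub_sigma_algebra; left.
have [taut'|ttau] := ltP tau t%:Z.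
  apply: (subset_trans _ FG); apply: sigma_of_measurable.
  by exists (tau, i).
have -> : tau = t%:Z by lia.
(* The new reading is the innovation plus a function of the past. *)
have zE : component (z t%:Z) i =
    component (fun omega => innovation t omega + rows s C *m xhat t omega)
      (enum_rank_in si i).
  apply/funext => omega; rewrite /component /innovation subrK mxE.
  by rewrite enum_rankK_in.
rewrite zE; move: (enum_rank_in si i).
apply/(vec_measurable_wrtP _ sG); apply: random_vectorD.
  apply/(vec_measurable_wrtP _ sG) => l E hE; apply: sub_sigma_algebra; right.
  by apply: sigma_of_measurable hE; exists l.
apply: random_vector_mulmx; apply/(vec_measurable_wrtP _ sG) => l.
exact: (subset_trans (@kalman_estimate_wrt t l)).
Qed.

End KalmanFiltering.

(** * The erasing attack *)

Section Attack.
Context {d : measure_display} {T : measurableType d} {R : realType}.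
Variable P : probability T R.
Variables (n m p : nat).
Variables (A : 'M[R]_n) (B : 'M[R]_(n, m)) (C : 'M[R]_(p, n)).
Variables (sigma_w sigma_v : R).
Variable u : nat -> 'cV[R]_m.
Variable x : nat -> T -> 'cV[R]_n.
Variables (w : nat -> T -> 'cV[R]_n) (v : nat -> T -> 'cV[R]_p).
Variable z : int -> T -> 'cV[R]_p.
Hypothesis hsys : attack_free_system P A B C sigma_w sigma_v u x w v z.
Variable kappa : {set 'I_p}.

(** The attacked readings become constant. *)
Definition erasing_attack : int -> T -> 'cV[R]_p :=
  fun t omega => \col_i (if i \in kappa then - z t omega i 0 else 0).

(** It is enough for the adversary to know the readings of the attacked sensors
    up to the present, which only depend on the initial data and on the noises up
    to the present. *)
Lemma erasing_attack_admissible k :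
  #|kappa| = k -> k_adversary P w v z k kappa erasing_attack.
Proof.
move=> kk; split=> //; first by move=> t omega i /negbTE ik; rewrite mxE ik.
pose K (t : int) := sigma_readings z [set q | q.1 <= t /\ q.2 \in kappa].
have KH (t : int) : K t `<=` history x w v z (t + 1) (t + 1).
  by apply: (readings_wrt hsys) => -[tau i] [/= qt _]; split; lia.
have sF := family_algebraP (randomness x w v z).
(* [K] is the least knowledge that the definition allows. *)
exists K; split.
- by move=> t; exact: sigma_of_algebra.
- by move=> t; apply: (subset_trans (@KH t)); exact: (history_measurable hsys).
- move=> t t' tt'; apply: sigma_of_sub; first exact: sigma_of_algebra.
  move=> _ [q [qt qk] <-]; apply: sigma_of_measurable; exists q => //.
  by split=> //; exact: le_trans tt'.
- by move=> t E.
- move=> t i; have sK : sigma_algebra setT (K t) by exact: sigma_of_algebra.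
  apply/(measurable_wrtP _ sK); have [ik|ik] := boolP (i \in kappa).
    rewrite (_ : component _ i = \- component (z t) i); last first.
      by apply/funext => omega; rewrite /component mxE ik.
    apply: measurable_funN; apply/(measurable_wrtP _ sK).
    by apply: sigma_of_measurable; exists (t, i).
  rewrite (_ : component _ i = cst 0)//.
  by apply/funext => omega; rewrite /component mxE (negbTE ik).
- move=> t; apply: (independent2_sub (@KH t) _
    (history_indep hsys (J := ~` elapsed (t + 1) (t + 1)) _)) => //.
  apply: sigma_of_sub => // _ [q /= tq <-].
  by apply: process_noise_wrt => /=; lia.
- move=> t i _; apply: (independent2_sub (@KH t) _
    (history_indep hsys (J := ~` elapsed (t + 1) (t + 1)) _)) => //.
  apply: sigma_of_sub => // _ [t' /= tt' <-].
  by apply: sensor_noise_wrt => /=; lia.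
Qed.

Lemma erased_information (t : nat) :
  oracle_information z erasing_attack t `<=`
  sigma_readings z [set q | q.1 < t%:Z /\ q.2 \in ~: kappa].
Proof.
set G := sigma_readings _ _; have sG : sigma_algebra setT G by exact: sigma_of_algebra.
apply: sigma_of_sub => // _ [[tau i] /= taut <-].
have [ik|ik] := boolP (i \in kappa).
  apply/(measurable_wrtP _ sG); rewrite (_ : component _ i = cst 0)//.
  by apply/funext => omega; rewrite /component !mxE ik subrr.
rewrite (_ : component _ i = component (z tau) i); last first.
  by apply/funext => omega; rewrite /component !mxE (negbTE ik) addr0.
by apply: sigma_of_measurable; exists (tau, i) => //=; rewrite inE.
Qed.

End Attack.

Theorem theorem1 (R : realType) (d : measure_display) (T : measurableType d)
    (P : probability T R) (n m p k : nat) (hk : (k <= p)%N)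
    (A : 'M[R]_n) (B : 'M[R]_(n, m)) (C : 'M[R]_(p, n))
    (sigma_w sigma_v : R) (u : nat -> 'cV[R]_m)
    (x w : nat -> T -> 'cV[R]_n) (v : nat -> T -> 'cV[R]_p)
    (z : int -> T -> 'cV[R]_p)
    (hsys : attack_free_system P A B C sigma_w sigma_v u x w v z)
    (Pstar : {set 'I_p} -> 'M[R]_n) (xhat0 : {set 'I_p} -> T -> 'cV[R]_n)
    (hsteady : forall s : {set 'I_p}, #|s| = (p - k)%N ->
       steady_state_kalman P A B C sigma_w sigma_v u x z s (Pstar s) (xhat0 s))
    (s_worst : {set 'I_p}) (hworst : is_worst_subset (p - k) Pstar s_worst) :
  exists (kappa : {set 'I_p}) (a : int -> T -> 'cV[R]_p),
    k_adversary P w v z k kappa a /\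
    forall (t : nat) (xo : T -> 'cV[R]_n),
      mmse_estimator P (oracle_information z a t) (x t) xo ->
      (\tr (second_moment P (error (x t) xo)) >= (\tr (Pstar s_worst))%:E)%E.
Proof.
have [cards _] := hworst; have hst := hsteady _ cards.
exists (~: s_worst), (erasing_attack z (~: s_worst)); split.
  by apply: (erasing_attack_admissible hsys); rewrite cardsCs finset.setCK card_ord cards subKn.
move=> t xo [xo_wrt _].
pose xhat := kalman_estimate A B C sigma_w sigma_v u z s_worst (Pstar s_worst)
  (xhat0 s_worst).
have covE : second_moment P (error (x t) (xhat t)) = map_mx EFin (Pstar s_worst).
  exact: (steady_cov hst t).
apply: (second_moment_trace_le covE) => i.
pose F := sigma_readings z [set q | q.1 < t%:Z /\ q.2 \in s_worst].
have sF : sigma_algebra setT F by exact: sigma_of_algebra.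
have mF : F `<=` measurable.
  apply: (subset_trans (@past_history _ _ _ _ _ _ _ _ _ _ _ _ _ _ _ _ _ hsys _ t)).
  exact: (history_measurable hsys).
have gauss : gaussian_given P F (error (x t) (xhat t)) _ :=
  kalman_filter_gaussian hsys hst t.
have ie := gg_integrable gauss i.
have centE : centered P F (component (error (x t) (xhat t)) i).
  move=> D FD; rewrite -[RHS](gg_stein gauss (test_cst1 n) i FD).
  apply: eq_integral => omega _; rewrite /stein_term mulr1 mulmx0.
  by have -> : (0 : 'cV[R]_n) i 0 = 0 by [rewrite mxE]; rewrite subr0.
(* The oracle estimate differs from the Kalman estimate by a function of the past. *)
have corr : measurable_wrt F (component (fun omega => xhat t omega - xo omega) i).
  move: i {ie centE}; apply/(vec_measurable_wrtP _ sF); apply: random_vectorB.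
    by apply/(vec_measurable_wrtP _ sF); exact: (kalman_estimate_wrt hst).
  apply/(vec_measurable_wrtP _ sF) => j; apply: (subset_trans (xo_wrt j)).
  by have := @erased_information _ _ _ _ z (~: s_worst) t; rewrite finset.setCK.
have ie2 : P.-integrable setT
    (EFin \o (fun omega => component (error (x t) (xhat t)) i omega ^+ 2)).
  apply/integrableP; split.
    apply/measurable_EFinP; apply: measurable_funX; exact: (gg_measurable gauss).
  under eq_integral do rewrite /= ger0_norm ?sqr_ge0//.
  by rewrite -second_moment_diag covE mxE ltry.
apply: le_trans (centered_optimal sF mF ie ie2 centE corr) _.
rewrite le_eqVlt; apply/orP; left; apply/eqP; apply: eq_integral => omega _.
by congr (_ ^+ 2)%:E; rewrite /component /error !mxE addrA subrK.
Qed.
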